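(* Let $r\in(0,\infty)$. Let $P$ be a Borel probability measure on $\mathbb{R}^d$ with absolutely continuous part $P^a\ne0$ and $\int\|x\|^{r+\delta}\,dP(x)<+\infty$ for some $\delta>0$. For every $n\ge1$, let $\alpha_n$ be an $L^r$-optimal $n$-quantizer for $P$. (a) (Critical case $s=d+r$.) Assume there is a real $\underline\vartheta>0$ such that for every $\vartheta\in(0,\underline\vartheta\wedge (d+r))$ there exist real numbers $M\ge0$ and $b\in(0,1/2)$ such that $$\int_{B(0,M)^c}\left(\sup_{t\le 2b\|x\|}\frac{\lambda_d(B(x,t))}{P(B(x,t))}\right)^{1-\frac{\vartheta}{d+r}}\|x\|^{\vartheta}\,dP(x)<+\infty.$$ Then $$\forall\,\varepsilon\in(0,1+r/d),\qquad \limsup_n n^{1+\frac rd-\varepsilon}\int_{\mathbb{R}^d}d(x,\alpha_n)^{d+r}\,dP(x)<+\infty.$$ (b) (Super-critical case.) Let $s>d+r$. Assume there are real numbers $\vartheta\in(s-(d+r),s)$, $M\ge0$ and $b\in(0,1/2)$ such that $$\int_{B(0,M)^c}\left(\sup_{t\le 2b\|x\|}\frac{\lambda_d(B(x,t))}{P(B(x,t))}\right)^{\frac{s-\vartheta}{d+r}}\|x\|^{\vartheta}\,dP(x)<+\infty.$$ Then $$\sup_n n^{\frac{s-\vartheta}{d}}\int_{\mathbb{R}^d}d(x,\alpha_n)^s\,dP(x)<+\infty.$$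
   Context: $\mathbb{R}^d$ ($d\ge 1$) is equipped with an arbitrary norm $\|\cdot\|$; $d(x,A)=\inf_{a\in A}\|x-a\|$; $B(x,\rho)$ is the closed ball with center $x$ and radius $\rho$; $\lambda_d$ is Lebesgue measure; $P^a$ is the absolutely continuous part of $P$ with respect to $\lambda_d$. The suprema are over nonnegative $t$, with the convention $\frac00:=0$. An $L^r$-optimal $n$-quantizer for $P$ is a nonempty set $\alpha\subset\mathbb{R}^d$ with $\mathrm{card}(\alpha)\le n$ minimizing $\int d(x,\alpha)^r\,dP(x)$ among all nonempty subsets of $\mathbb{R}^d$ of cardinality at most $n$. *)

(* Defs.v *)
From HB Require Import structures.
From mathcomp Require Import all_boot all_order all_algebra.
From mathcomp Require Import all_classical all_reals all_analysis.
From mathcomp Require Import measurable_realfun.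
Set Implicit Arguments. Unset Strict Implicit. Unset Printing Implicit Defensive.
Import Order.TTheory GRing.Theory Num.Theory.
Import numFieldNormedType.Exports.
Local Open Scope classical_set_scope.
Local Open Scope ring_scope.

Section borel_rV.
Context {R : realType} {d : nat}.

(* 'rV[R]_d carries its Borel sigma-algebra; the library topology is that of
   the sup norm, which all norms on 'rV[R]_d induce. *)
HB.instance Definition _ :=
  @isMeasurable.Build (sigma_display (@open 'rV[R]_d)) 'rV[R]_d <<s @open 'rV[R]_d >>
    (@sigma_algebra0 _ setT _) (@sigma_algebraC _ _)
    (@sigma_algebra_bigcup _ setT _).

End borel_rV.

Section measurable_rV.
Context {R : realType}.

Lemma measurable_coord_rV (n : nat) (i : 'I_n) :
  measurable_fun [set: 'rV[R]_n] (fun v : 'rV[R]_n => v ord0 i).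
Proof.
apply: (measurability _ (RGenOInfty.measurableE R)).
move=> _ [_ [a ->] <-]; rewrite setTI; apply: sub_sigma_algebra.
by apply: open_comp; [move=> v _; exact: coord_continuous|exact: interval_open].
Qed.

Lemma measurable_fun_rV d (T : measurableType d) (n : nat) (f : T -> 'rV[R]_n) :
  (forall i, measurable_fun [set: T] (fun x => f x ord0 i)) ->
  measurable_fun [set: T] f.
Proof.
move=> mf.
apply: (@measurability _ _ _ _ _ _ (@open 'rV[R]_n)) => // _ [U oU <-].
rewrite setTI.
pose B (qk : 'rV[rat]_n * nat) : set 'rV[R]_n :=
  ball (map_mx ratr qk.1 : 'rV[R]_n) (qk.2.+1%:R^-1).
have -> : f @^-1` U =
    \bigcup_qk (if `[< B qk `<=` U >] then f @^-1` B qk else set0).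
  apply/seteqP; split => [x Ufx|x [qk _]]; last first.
    by case: asboolP => // + Bx; exact.
  have [e /= e0 eU] := (nbhs_ballP _ _).1 (open_nbhs_nbhs (conj oU Ufx)).
  have [k ke] : exists k, k.+1%:R^-1 < e / 2.
    exists (Num.truncn (e / 2)^-1).
    by rewrite invf_plt ?posrE ?divr_gt0// truncnS_gt.
  have qex i : exists q : rat, ball (f x ord0 i) k.+1%:R^-1 (ratr q).
    have k0 : 0 < k.+1%:R^-1 :> R by rewrite invr_gt0.
    have [y [By [q _ qE]]] := @dense_rat R _
      (ex_intro _ _ (ballxx (f x ord0 i) k0)) (ball_open _ _).
    by exists q; rewrite qE.
  have [q qP] := choice qex.
  have Bfx : B (\row_i q i, k) (f x).
    split=> // i j; rewrite !mxE; apply: ball_sym.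
    by rewrite (ord1 i).
  exists (\row_i q i, k) => //=; case: asboolP => // nB; case: nB => y By.
  apply: eU; apply: (@le_ball _ _ _ (e / 2 + e / 2)); first by rewrite -splitr.
  apply: ball_triangle (le_ball (ltW ke) By).
  by apply: ball_sym; apply: (le_ball (ltW ke)).
apply: countable_bigcupT_measurable => [|[q k]]; first exact: countableP.
case: ifPn => // _.
have -> : f @^-1` B (q, k) =
    \bigcap_(i in [set: 'I_n]) (fun x => f x ord0 i) @^-1`
       ball (ratr (q ord0 i) : R) k.+1%:R^-1.
  apply/seteqP; split => [x [_ Bx] i _|x Bx].
    by have := Bx ord0 i; rewrite mxE.
  by split=> [//|i j]; rewrite mxE (ord1 i); exact: Bx.
apply: fin_bigcap_measurable => [|i _]; first exact: finite_finset.
by rewrite -[X in measurable X]setTI; apply: mf => //; exact: measurable_ball.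
Qed.

End measurable_rV.

Section lebesgue_measure_rV.
Context {R : realType}.

Definition cons_rV n (p : measurableTypeR R * 'rV[R]_n) : 'rV[R]_n.+1 :=
  \row_i (if unlift ord0 i is Some j then p.2 ord0 j else p.1).

Lemma cons_rV0 n p : @cons_rV n p ord0 ord0 = p.1.
Proof. by rewrite mxE unlift_none. Qed.

Lemma cons_rVS n p (i : 'I_n) : @cons_rV n p ord0 (lift ord0 i) = p.2 ord0 i.
Proof. by rewrite mxE liftK. Qed.

Lemma measurable_cons_rV n : measurable_fun setT (@cons_rV n).
Proof.
apply: measurable_fun_rV => i; case: (unliftP ord0 i) => [j ->|->].
- under eq_fun do rewrite cons_rVS.
  exact: measurableT_comp (measurable_coord_rV j) measurable_snd.
- under eq_fun do rewrite cons_rV0.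
  exact: measurable_fst.
Qed.

HB.instance Definition _ n :=
  isMeasurableFun.Build _ _ _ _ (@cons_rV n) (@measurable_cons_rV n).

Section step.
Variables (n : nat) (m : {sigma_finite_measure set 'rV[R]_n -> \bar R}).

Definition lebesgue_rV_step : set 'rV[R]_n.+1 -> \bar R :=
  pushforward (lebesgue_measure \x m)%E (@cons_rV n).

Let step0 : lebesgue_rV_step set0 = 0%E.
Proof. exact: measure0. Qed.

Let step_ge0 A : (0 <= lebesgue_rV_step A)%E.
Proof. exact: measure_ge0. Qed.

Let step_sigma_additive : semi_sigma_additive lebesgue_rV_step.
Proof. exact: measure_semi_sigma_additive. Qed.

HB.instance Definition _ := isMeasure.Build _ _ _ lebesgue_rV_step
  step0 step_ge0 step_sigma_additive.

Let step_sigma_finite : sigma_finite setT lebesgue_rV_step.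
Proof.
pose h (v : 'rV[R]_n.+1) : measurableTypeR R * 'rV[R]_n :=
  (v ord0 ord0, \row_j v ord0 (lift ord0 j)).
have mh : measurable_fun setT h.
  apply: measurable_fun_pair; first exact: measurable_coord_rV.
  apply: measurable_fun_rV => i; under eq_fun do rewrite mxE.
  exact: measurable_coord_rV.
have hK p : h (cons_rV p) = p.
  case: p => x v; rewrite /h cons_rV0; congr pair.
  by apply/rowP => j; rewrite mxE cons_rVS.
have /sigma_finiteP[F [TF ndF mF]] := sigma_finiteT (@lebesgue_measure R).
have /sigma_finiteP[G [TG ndG mG]] := sigma_finiteT m.
exists (fun k => h @^-1` (F k `*` G k)).
  rewrite -preimage_bigcup; apply/esym; rewrite -subTset => v _ /=.
  have [i _ Fi] : (\bigcup_i F i) (h v).1 by rewrite -TF.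
  have [j _ Gj] : (\bigcup_i G i) (h v).2 by rewrite -TG.
  exists (maxn i j) => //; split.
    by move: Fi; exact/subsetPset/ndF/leq_maxl.
  by move: Gj; exact/subsetPset/ndG/leq_maxr.
move=> k; have [[mFk Fk] [mGk Gk]] := (mF k, mG k); split.
  by rewrite -[X in measurable X]setTI; apply: mh => //; exact: measurableX.
rewrite /lebesgue_rV_step /pushforward.
have -> : @cons_rV n @^-1` (h @^-1` (F k `*` G k)) = F k `*` G k.
  by apply/funext => p; rewrite -[in RHS](hK p).
by rewrite product_measure1E// lte_mul_pinfty// ge0_fin_numE.
Qed.

HB.instance Definition _ := Measure_isSigmaFinite.Build _ _ _ lebesgue_rV_step
  step_sigma_finite.

End step.

(* The n-fold product of the one-dimensional Lebesgue measure; by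
   lebesgue_rV_box below it is the Lebesgue measure on Borel sets. *)
Fixpoint lebesgue_rV n : {sigma_finite_measure set 'rV[R]_n -> \bar R} :=
  match n with
  | 0 => \d_ (0 : 'rV[R]_0)
  | n'.+1 => lebesgue_rV_step (lebesgue_rV n')
  end.

Lemma lebesgue_rV_box n (a b : 'rV[R]_n) : (forall i, a ord0 i <= b ord0 i) ->
  lebesgue_rV n [set v : 'rV[R]_n | forall i, v ord0 i \in `]a ord0 i, b ord0 i]] =
  (\prod_i (b ord0 i - a ord0 i))%:E.
Proof.
elim: n a b => [|n ih] a b ab.
  by rewrite big_ord0 /= diracE mem_set// => -[].
rewrite big_ord_recl EFinM /= /lebesgue_rV_step /pushforward.
pose tl (v : 'rV[R]_n.+1) : 'rV[R]_n := \row_j v ord0 (lift ord0 j).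
have -> : @cons_rV n @^-1` [set v : 'rV[R]_n.+1 | forall i, v ord0 i \in `]a ord0 i, b ord0 i]] =
   (`]a ord0 ord0, b ord0 ord0]%classic : set (measurableTypeR R)) `*`
   [set v : 'rV[R]_n | forall i, v ord0 i \in `]tl a ord0 i, tl b ord0 i]].
  apply/seteqP; split => [p pab|p [p1 p2] i]; last first.
    case: (unliftP ord0 i) => [j ->|->]; last by rewrite cons_rV0.
    by rewrite cons_rVS; have := p2 j; rewrite !mxE.
  split => [|i /=]; first by have := pab ord0; rewrite cons_rV0.
  by have := pab (lift ord0 i); rewrite cons_rVS !mxE.
rewrite product_measure1E//=; last first.
  have -> : [set v : 'rV[R]_n | forall i, v ord0 i \in `]tl a ord0 i, tl b ord0 i]] =
    \bigcap_(i in [set: 'I_n]) (fun v => v ord0 i) @^-1`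
       `]tl a ord0 i, tl b ord0 i]%classic.
    by apply/seteqP; split => [x xi i _|x xi i]; exact: xi.
  apply: fin_bigcap_measurable => [|i _]; first exact: finite_finset.
  by rewrite -[X in measurable X]setTI; apply: measurable_coord_rV.
rewrite ih => [|i]; last by rewrite !mxE.
congr (_ * _)%E; last first.
  by congr EFin; apply: eq_bigr => i _; rewrite !mxE.
rewrite lebesgue_measure_itv/= lte_fin; case: ltP => // ba.
by rewrite (@le_anti _ _ (a ord0 ord0) (b ord0 ord0)) ?subrr// ab ba.
Qed.

End lebesgue_measure_rV.

Section absolutely_continuous_part.
Context d (T : measurableType d) (R : realType).
Implicit Types mu nu P Pa : {measure set T -> \bar R}.

Definition mutually_singular mu nu :=
  exists2 S, measurable S & mu S = 0%E /\ nu (~` S) = 0%E.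

(* By uniqueness of the Lebesgue decomposition, this determines Pa on
   measurable sets when P is finite and mu is sigma-finite. *)
Definition is_ac_part mu P Pa :=
  Pa `<< mu /\
  exists2 Ps : {measure set T -> \bar R}, mutually_singular Ps mu &
    forall A, measurable A -> P A = (Pa A + Ps A)%E.

End absolutely_continuous_part.

Section quantization.
Context {R : realType} {d : nat}.
Implicit Types (N : 'rV[R]_d -> R) (P : probability 'rV[R]_d R)
  (x : 'rV[R]_d) (A : set 'rV[R]_d).

(* Nonnegativity follows from homogeneity and the triangle inequality. *)
Definition is_norm N :=
  [/\ forall x, N x = 0 -> x = 0,
      forall (a : R) x, N (a *: x) = `|a| * N x &
      forall x y, N (x + y) <= N x + N y].

Definition dist_set N x A : R := inf [set N (x - a) | a in A].

Definition cball N x (t : R) : set 'rV[R]_d := [set y | N (x - y) <= t].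

(* In \bar R the inverse of 0 is +oo and 0 * +oo = 0, so that 0 / 0 = 0,
   whereas c / 0 = +oo for c > 0. *)
Definition sup_ball_ratio N P x (T : R) : \bar R :=
  ereal_sup [set (lebesgue_rV d (cball N x t) / P (cball N x t))%E
            | t in [set t : R | 0 <= t <= T]].

Definition ball_ratio_integral N P (M b p theta : R) : \bar R :=
  (\int[P]_(x in ~` cball N 0%R M)
     (sup_ball_ratio N P x (2 * b * N x) `^ p * (N x `^ theta)%:E))%E.

Definition quantization_error N P (s : R) A : \bar R :=
  (\int[P]_x (dist_set N x A `^ s)%:E)%E.

Definition is_optimal_quantizer N P (r : R) (n : nat) A :=
  [/\ A !=set0, (A #<= `I_n)%card &
      forall B : set 'rV[R]_d, B !=set0 -> (B #<= `I_n)%card ->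
        (quantization_error N P r A <= quantization_error N P r B)%E].

End quantization.

(* Main.v *)
Require Import Defs.
From HB Require Import structures.
From mathcomp Require Import all_boot all_order all_algebra.
From mathcomp Require Import all_classical all_reals all_analysis.
From mathcomp Require Import measurable_realfun finmap.
From mathcomp Require Import ring lra.
Set Implicit Arguments. Unset Strict Implicit. Unset Printing Implicit Defensive.
Import Order.TTheory GRing.Theory Num.Theory.
Import numFieldNormedType.Exports.
Local Open Scope classical_set_scope.
Local Open Scope ring_scope.

(** Write D(x) for the distance of x to the optimal quantizer with n points
and u = n^(-1/d). Everything rests on a pointwise bound ([micro_macro]):
D(x)^r P(B(x, b D(x))) <= C u^(d+r) for every x and every n >= 1. It says
that no ball on the scale of its own distance to the quantizer can carry much
mass.

To get it, delete a center a of the quantizer and insert x instead. On the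
ball B(x, b D(x)) the distance drops from at least (1-b) D(x) to at most
b D(x), while elsewhere it can grow only at the points whose single nearest
center is a, and there by at most the distance from a to its closest fellow
center. Optimality says that the gain never exceeds the loss. Summing over
many deleted centers, each point pays at most once, so the total loss is of
the order of the whole error, and the gain times the number of deletions is
bounded by it ([exchange]). Three facts make this u^(d+r):
- the optimal error is O(u^r), by comparison with an explicit product grid
  whose gaps grow with the norm, paid for by the moment of order r + delta
  ([optimal_error_rate]);
- a fixed fraction of the n centers lies in a bounded ball: otherwise a set of
  small Lebesgue measure would contain all points close to the quantizer, and
  the mass which the absolutely continuous part leaves outside it would make
  the error too large ([many_bounded_centers]);
- by pigeonhole, at least half of these have another center within O(u)
  ([many_close_centers]).

Now fix s = theta + (d+r) q with theta > 0 and 0 < q <= 1, and let E be the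
right-hand side of the micro-macro inequality. Near the origin, covering
{D > tau} by about tau^(-d) balls of radius b tau gives the weak-type bound
P(D > tau) = O(E tau^(-(d+r))), hence P(D > tau) = O(E^q tau^(-(d+r)q)), and
summing over dyadic tau gives an integral of D^s of order E^q, thanks to
theta > 0 ([inner_integral]). Far from the origin D(x) <= 2 ||x||, because
D(0) is bounded in n; as Lebesgue measure of B(x, b D(x)) is of order D(x)^d,
the micro-macro inequality bounds D(x)^(d+r) / E by the ratio of measures, so
D(x)^s / E^q is at most a constant times the integrand of the hypothesis
([outer_integral]). Together the error of order s is
O(E^q) = O(n^(-(s-theta)/d)) ([mismatch_rate]). The super-critical case is
q = (s-theta)/(d+r); the critical case is s = d+r with theta <= eps d. *)

(** * Norms on the space of row vectors *)

Section borel_continuous.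
Context {R : realType} {d : nat}.

Lemma continuous_measurable_rV (f : 'rV[R]_d -> R) :
  continuous f -> measurable_fun [set: 'rV[R]_d] f.
Proof.
move=> cf; apply: (measurability _ (RGenOInfty.measurableE R)).
move=> _ [_ [a ->] <-]; rewrite setTI; apply: sub_sigma_algebra.
by apply: open_comp; [move=> v _; exact: cf|exact: interval_open].
Qed.

Lemma coord_le_mx_norm (x : 'rV[R]_d) i : `|x ord0 i| <= `|x|.
Proof.
rewrite [leRHS]/Num.norm /= mx_normrE; apply/bigmax_geP; right => /=.
by exists (ord0, i).
Qed.

Lemma mx_norm_leP (x : 'rV[R]_d) (t : R) : 0 <= t ->
  (forall i, `|x ord0 i| <= t) -> `|x| <= t.
Proof.
move=> t0 xt; rewrite [leLHS]/Num.norm /= mx_normrE; apply/bigmax_leP; split=> //.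
by move=> [i j] _ /=; rewrite ord1.
Qed.

End borel_continuous.

Section norm.
Context {R : realType} {d : nat} {N : 'rV[R]_d -> R}.
Hypothesis hN : is_norm N.

Lemma norm_eq0 x : N x = 0 -> x = 0. Proof. by case: hN => + _ _; exact. Qed.

Lemma normZ a x : N (a *: x) = `|a| * N x. Proof. by case: hN. Qed.

Lemma normD x y : N (x + y) <= N x + N y. Proof. by case: hN. Qed.

Lemma norm0 : N 0 = 0.
Proof. by rewrite -(scale0r 0) normZ normr0 mul0r. Qed.

Lemma normN x : N (- x) = N x.
Proof. by rewrite -scaleN1r normZ normrN1 mul1r. Qed.

Lemma norm_ge0 x : 0 <= N x.
Proof.
have := normD x (- x); rewrite subrr norm0 normN => h.
by rewrite -(pmulr_rge0 _ (ltr0n R 2)) mulr2n mulrDl mul1r.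
Qed.

Lemma norm_distC x y : N (x - y) = N (y - x).
Proof. by rewrite -normN opprB. Qed.

Lemma norm_tri z x y : N (x - y) <= N (x - z) + N (z - y).
Proof. by apply: le_trans (normD _ _); rewrite addrA subrK. Qed.

Lemma norm_gt0 x : x != 0 -> 0 < N x.
Proof.
move=> x0; rewrite lt_neqAle norm_ge0 andbT eq_sym.
by apply: contra x0 => /eqP/norm_eq0/eqP.
Qed.

Lemma norm_ub : exists2 K : R, 0 < K & forall x, N x <= K * `|x|.
Proof.
pose K := 1 + \sum_(i < d) N (delta_mx ord0 i).
have K0 : 0 < K by rewrite ltr_wpDr// sumr_ge0// => i _; exact: norm_ge0.
exists K => // x.
have Nsum (F : 'I_d -> 'rV[R]_d) : N (\sum_i F i) <= \sum_i N (F i).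
  elim/big_ind2 : _ => [|u a v b ua vb|//]; first by rewrite norm0.
  by apply: le_trans (normD _ _) _; exact: lerD.
rewrite [in N _](row_sum_delta x); apply: (le_trans (Nsum _)).
apply: (@le_trans _ _ (\sum_(i < d) N (delta_mx ord0 i) * `|x|)).
  apply: ler_sum => i _; rewrite normZ mulrC ler_wpM2l ?norm_ge0//.
  exact: coord_le_mx_norm.
by rewrite -mulr_suml ler_wpM2r// lerDr.
Qed.

(** The one-sided bound is symmetric in disguise, so it is a Lipschitz bound for
N, and N is dominated by the norm that defines the topology. *)
Lemma norm_lipschitz_continuous (f : 'rV[R]_d -> R) :
  (forall x y, f x <= N (x - y) + f y) -> continuous f.
Proof.
move=> fN; have [K K0 NK] := norm_ub.
move=> x; apply/(@cvgrPdist_le _ _ _ (nbhs x) (nbhs_filter x)) => e e0.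
have Ke : 0 < K^-1 * e by rewrite mulr_gt0// invr_gt0.
have : \forall y \near nbhs x, `|x - y| <= K^-1 * e.
  by move: (K^-1 * e) Ke; apply/cvgrPdist_le; exact: cvg_id.
apply: filterS => y xy; apply: (@le_trans _ _ (N (x - y))).
  rewrite ler_norml lerNl opprB !lerBlDr fN andbT.
  by have := fN y x; rewrite norm_distC.
by rewrite (le_trans (NK _))// -ler_pdivlMl.
Qed.

Lemma is_norm_continuous : continuous N.
Proof.
apply: norm_lipschitz_continuous => x y.
by have := normD (x - y) y; rewrite subrK.
Qed.

(** All norms are equivalent: N is continuous and does not vanish on the unit
sphere, which is compact. *)
Lemma norm_lb : exists2 k : R, 0 < k & forall x, k * `|x| <= N x.
Proof.
pose S := [set x : 'rV[R]_d | `|x| = 1].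
have [[x0 Sx0]|S0] := pselect (S !=set0); last first.
  exists 1 => // x; have [->|x_neq0] := eqVneq x 0.
    by rewrite normr0 mulr0 norm0.
  exfalso; apply: S0; exists (`|x|^-1 *: x).
  by rewrite /S/= normrZ normfV normr_id mulVf// normr_eq0.
have cS : compact S.
  apply: bounded_closed_compact.
    exists 1; split => // M M1 x /= ->; exact: ltW.
  have -> : S = (@Num.norm _ 'rV[R]_d) @^-1` [set 1] by [].
  apply: closed_comp => [x _|]; first exact: norm_continuous.
  exact: closed_eq.
have [c cS' cmin] := compact_EVT_min (ex_intro _ _ Sx0) cS
   (continuous_subspaceT is_norm_continuous).
exists (N c).
  apply: norm_gt0; apply/negP => /eqP c0.
  by move/set_mem : cS'; rewrite /S /= c0 normr0 => /eqP; rewrite eq_sym oner_eq0.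
move=> x; have [->|x_neq0] := eqVneq x 0; first by rewrite normr0 mulr0 norm0.
have nx : 0 < `|x| by rewrite normr_gt0.
rewrite -ler_pdivlMr// mulrC.
have -> : `|x|^-1 * N x = N (`|x|^-1 *: x).
  by rewrite normZ gtr0_norm// invr_gt0.
by apply: cmin; apply/mem_set; rewrite /S /= normrZ normfV normr_id mulVf// gt_eqF.
Qed.

End norm.

(** * Integrals, powers and the distance to a set *)

Section lower_integral.
Local Open Scope ereal_scope.
Context d (T : measurableType d) (R : realType).
Variable mu : {measure set T -> \bar R}.
Import HBNNSimple.

(** The integral of a nonnegative function is a supremum over the simple
functions below it, so it is monotone even when the functions are not
measurable. This is how the hypothesis on the ratio of measures is used: nothing
is known about the measurability of its supremum over t. *)
Lemma le_lower_integral (D E : set T) (f g : T -> \bar R) :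
  D `<=` E -> (forall x, D x -> 0 <= f x) -> (forall x, E x -> 0 <= g x) ->
  (forall x, D x -> f x <= g x) ->
  \int[mu]_(x in D) f x <= \int[mu]_(x in E) g x.
Proof.
move=> DE f0 g0 fg; rewrite (integral_mkcond D) (integral_mkcond E).
have f0' x : 0 <= (f \_ D) x by apply: erestrict_ge0.
have g0' x : 0 <= (g \_ E) x by apply: erestrict_ge0.
rewrite !ge0_integralTE//; apply: ereal_sup_le => _ [h hf <-] /=.
exists h => // x.
apply: (le_trans (hf x)); rewrite /patch; case: ifPn => [/set_mem Dx|_].
  by rewrite mem_set; [exact: fg|exact: DE].
exact: g0'.
Qed.

Lemma integral_cst_probability (P : probability T R) (k : R) :
  \int[P]_x k%:E = k%:E.
Proof. by rewrite integral_cst//= probability_setT mule1. Qed.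

End lower_integral.

Lemma powRD_le (R : realType) (u v r : R) : 0 <= u -> 0 <= v -> 0 <= r ->
  (u + v) `^ r <= 2 `^ r * (u `^ r + v `^ r).
Proof.
move=> u0 v0 r0; wlog uv : u v u0 v0 / u <= v.
  move=> h; have [|/ltW vu] := leP u v; first exact: h.
  by rewrite addrC (addrC (_ `^ r)); exact: h.
apply: (@le_trans _ _ ((2 * v) `^ r)).
  by apply: ge0_ler_powR; rewrite ?nnegrE ?addr_ge0 ?mulr_ge0//; lra.
by rewrite powRM// ler_wpM2l ?powR_ge0// lerDr powR_ge0.
Qed.

Section dist_set.
Context {R : realType} {d : nat} {N : 'rV[R]_d -> R}.
Hypothesis hN : is_norm N.
Implicit Types (x y a : 'rV[R]_d) (A : set 'rV[R]_d).

Lemma has_inf_dist x A : has_lbound [set N (x - a) | a in A].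
Proof. by exists 0 => _ [a _ <-]; exact: (norm_ge0 hN). Qed.

Lemma dist_set_le x A a : A a -> dist_set N x A <= N (x - a).
Proof. by move=> Aa; apply: ge_inf; [exact: has_inf_dist|exists a]. Qed.

Lemma le_dist_set x A t : A !=set0 -> (forall a, A a -> t <= N (x - a)) ->
  t <= dist_set N x A.
Proof.
move=> [a Aa] tA; apply: lb_le_inf; first by exists (N (x - a)), a.
by move=> _ [c Ac <-]; exact: tA.
Qed.

Lemma dist_set_ge0 x A : 0 <= dist_set N x A.
Proof.
have [A0|/set0P/negP/negPn/eqP ->] := pselect (A !=set0).
  by apply: le_dist_set => // a _; exact: (norm_ge0 hN).
by rewrite /dist_set image_set0 inf0.
Qed.

Lemma dist_set_tri x y A : A !=set0 ->
  dist_set N x A <= N (x - y) + dist_set N y A.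
Proof.
move=> A0; rewrite -lerBlDl; apply: le_dist_set => // a Aa.
by rewrite lerBlDl (le_trans (dist_set_le x Aa))// (norm_tri hN y).
Qed.

Lemma dist_set_attained x (F : {fset 'rV[R]_d}) : [set` F] !=set0 ->
  exists2 c, c \in F & dist_set N x [set` F] = N (x - c).
Proof.
case=> a0 /= a0F.
have [c _ cmin] := @arg_minP _ _ _ [` a0F]%fset xpredT
  (fun c : F => N (x - val c)) isT.
exists (val c); first exact: valP.
apply/eqP; rewrite eq_le dist_set_le/=; last exact: valP.
apply: le_dist_set; first by exists a0.
by move=> a aF; exact: (cmin [` aF]%fset isT).
Qed.

Lemma measurable_dist A : A !=set0 ->
  measurable_fun [set: 'rV[R]_d] (fun x => dist_set N x A).
Proof.
move=> A0; apply: continuous_measurable_rV.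
by apply: (norm_lipschitz_continuous hN) => x y; exact: dist_set_tri.
Qed.

Lemma measurable_dist_set A s : A !=set0 ->
  measurable_fun [set: 'rV[R]_d] (fun x => (dist_set N x A `^ s)%:E).
Proof.
move=> A0; apply/measurable_EFinP.
exact: measurableT_comp (measurable_powR s) (measurable_dist A0).
Qed.

Lemma measurable_norm_powR s :
  measurable_fun [set: 'rV[R]_d] (fun x => (N x `^ s)%:E).
Proof.
apply/measurable_EFinP; apply: (measurableT_comp (measurable_powR s)).
exact: continuous_measurable_rV (is_norm_continuous hN).
Qed.

Lemma measurable_cball x t : measurable (cball N x t).
Proof.
have mf : measurable_fun [set: 'rV[R]_d] (fun y => N (x - y)).
  apply: continuous_measurable_rV; apply: (norm_lipschitz_continuous hN).
  by move=> y z; rewrite [leRHS]addrC (norm_distC hN y z); exact: (norm_tri hN).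
have -> : cball N x t = [set: 'rV[R]_d] `&` (fun y => N (x - y)) @^-1` `]-oo, t].
  by apply/seteqP; split=> [y|y [_]]; rewrite /cball /= in_itv.
exact: mf.
Qed.

End dist_set.

(** * Replacing one center of a quantizer by another point *)

Section exchange.
Context {R : realType} {d : nat} {N : 'rV[R]_d -> R}.
Hypothesis hN : is_norm N.
Implicit Types (x y a : 'rV[R]_d) (F S : {fset 'rV[R]_d}).

(** The quantizer F where the center a gives way to x. *)
Definition swap F a x : {fset 'rV[R]_d} := (x |` (F `\ a))%fset.

Lemma card_swap F a x : a \in F -> (#|` swap F a x| <= #|` F|)%N.
Proof.
move=> aF; rewrite /swap (cardfsD1 a F) aF cardfsU1.
by rewrite leq_add2r leq_b1.
Qed.

Lemma swap_neq0 F a x : [set` swap F a x] !=set0.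
Proof. by exists x; rewrite /= /swap fset1U1. Qed.

Lemma dist_swap_new F a x y : dist_set N y [set` swap F a x] <= N (y - x).
Proof. by apply: (dist_set_le hN); rewrite /= /swap fset1U1. Qed.

Lemma dist_swap_old F a x y c : c \in F -> c != a ->
  dist_set N y [set` swap F a x] <= N (y - c).
Proof.
move=> cF ca; apply: (dist_set_le hN).
by rewrite /= /swap !inE cF ca orbT.
Qed.

(** Inside the ball every swap lowers the distance from at least (1 - b) D to
at most b D. Outside it, a swap matters only if it deletes the nearest center c
of y, which happens for a single a in S; the other center near c then serves y
at the price rho. *)
Lemma exchange_pointwise F S x (b rho r : R) y :
    0 < r -> 0 < b < 1 / 2 -> 0 <= rho -> [set` F] !=set0 ->
    (forall a, a \in S -> exists2 c, c \in F & c != a /\ N (a - c) <= rho) ->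
  let D := dist_set N x [set` F] in
  \sum_(a <- S) dist_set N y [set` swap F a x] `^ r +
    #|` S|%:R * ((1 - b) `^ r - b `^ r) * D `^ r * \1_(cball N x (b * D)) y <=
  #|` S|%:R * dist_set N y [set` F] `^ r +
    2 `^ r * (dist_set N y [set` F] `^ r + rho `^ r).
Proof.
move=> r0 /andP[b0 b12] rho0 F0 Srho; set D := dist_set N x _; rewrite /=.
have D0 : 0 <= D := dist_set_ge0 hN _ _.
have mono (u v : R) : 0 <= u -> u <= v -> u `^ r <= v `^ r.
  move=> u0 uv; apply: ge0_ler_powR; rewrite ?nnegrE//; first exact: ltW.
  exact: le_trans uv.
have sumS (c : R) : \sum_(a <- S) c = #|` S|%:R * c.
  by rewrite big_const_seq count_predT iter_addr addr0 mulr_natl.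
have dge0 := dist_set_ge0 hN.
have [yB|yB] := pselect (cball N x (b * D) y); last first.
  rewrite indicE memNset// mulr0 addr0.
  have [c cF yc] := dist_set_attained hN y F0.
  set h := 2 `^ r * _.
  have h0 : 0 <= h by rewrite mulr_ge0 ?addr_ge0 ?powR_ge0.
  apply: (@le_trans _ _ (\sum_(a <- S)
      (dist_set N y [set` F] `^ r + (if a == c then h else 0)))).
    rewrite big_seq [leRHS]big_seq; apply: ler_sum => a aS; case: eqP => [ac|/eqP ac]; last first.
      rewrite addr0; apply: mono => //; rewrite yc.
      by apply: dist_swap_old; rewrite // eq_sym.
    apply: (@le_trans _ _ h); last by rewrite lerDr powR_ge0.
    apply: le_trans (powRD_le (dge0 _ _) rho0 (ltW r0)).
    apply: mono => //; have [c' c'F [c'a ac']] := Srho a aS.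
    apply: (le_trans (dist_swap_old x y c'F c'a)).
    by rewrite (le_trans (norm_tri hN a _ _))// lerD// yc ac.
  rewrite big_split/= sumS lerD2l.
  have [cS|cS] := boolP (c \in S); last first.
    rewrite big_seq big1// => a aS; case: eqP => // ac.
    by rewrite -ac aS in cS.
  rewrite (big_fsetD1 c)//= eqxx big_seq big1 ?addr0// => a.
  by rewrite !inE => /andP[/negPf ->].
rewrite indicE mem_set// mulr1.
have yB' : N (y - x) <= b * D by rewrite (norm_distC hN).
apply: (@le_trans _ _ (#|` S|%:R * ((1 - b) * D) `^ r)).
  rewrite powRM//; last lra.
  apply: (@le_trans _ _ (\sum_(a <- S) (b * D) `^ r +
     #|` S|%:R * ((1 - b) `^ r - b `^ r) * D `^ r)).
    rewrite lerD2r; apply: ler_sum => a _; apply: mono => //.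
    exact: le_trans (dist_swap_new F a x y) yB'.
  by rewrite sumS powRM//; [lra|exact: ltW].
apply: ler_wpDr; first by rewrite mulr_ge0 ?addr_ge0 ?powR_ge0.
rewrite ler_wpM2l//; apply: mono; first by rewrite mulr_ge0//; lra.
rewrite mulrBl mul1r lerBlDl.
by apply: (le_trans (dist_set_tri hN _ y F0)); rewrite lerD2r.
Qed.

Lemma quantization_error_ge0 (P : probability 'rV[R]_d R) (s : R) A :
  (0 <= quantization_error N P s A)%E.
Proof. by apply: integral_ge0 => x _; rewrite lee_fin powR_ge0. Qed.

(** The pointwise bound integrated: since no swap can beat F, the gain on the
ball, counted once for each member of S, is at most the one-time loss. *)
Lemma exchange (P : probability 'rV[R]_d R) F S x (b rho r e : R) :
    0 < r -> 0 < b < 1 / 2 -> 0 <= rho -> [set` F] !=set0 ->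
    (forall a, a \in S -> exists2 c, c \in F & c != a /\ N (a - c) <= rho) ->
    quantization_error N P r [set` F] = e%:E ->
    (forall a, a \in S ->
      (e%:E <= quantization_error N P r [set` swap F a x])%E) ->
  let D := dist_set N x [set` F] in
  #|` S|%:R * ((1 - b) `^ r - b `^ r) * D `^ r * fine (P (cball N x (b * D)))
    <= 2 `^ r * (e + rho `^ r).
Proof.
move=> r0 b01 rho0 F0 Srho eE eS; set D := dist_set N x _; rewrite /=.
set g := #|` S|%:R * _ * D `^ r; have b0 : 0 < b by case/andP: b01.
have b1 : b <= 1 - b by case/andP: b01; lra.
have g0 : 0 <= g.
  apply: mulr_ge0 (powR_ge0 _ _); apply: mulr_ge0 => //; rewrite subr_ge0.
  by apply: ge0_ler_powR; rewrite ?nnegrE//; lra.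
pose B := cball N x (b * D); have mB : measurable B := measurable_cball hN _ _.
pose f1 a y := (dist_set N y [set` swap F a x] `^ r)%:E.
pose f2 y := (dist_set N y [set` F] `^ r)%:E.
have mf1 a : measurable_fun [set: 'rV[R]_d] (f1 a).
  exact: (measurable_dist_set hN r (swap_neq0 F a x)).
have mf2 : measurable_fun [set: 'rV[R]_d] f2 := measurable_dist_set hN r F0.
have f20 y : (0 <= f2 y)%E by rewrite lee_fin powR_ge0.
have f10 a y : (0 <= f1 a y)%E by rewrite lee_fin powR_ge0.
have k0 : 0 <= #|` S|%:R + 2 `^ r by rewrite addr_ge0 ?powR_ge0.
have L : (\int[P]_y (\sum_(a <- S) f1 a y + g%:E * (\1_B y)%:E) =
          \sum_(a <- S) \int[P]_y f1 a y + g%:E * P B)%E.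
  rewrite ge0_integralD//; last 4 first.
  - by move=> y _; apply: sume_ge0.
  - exact: emeasurable_sum.
  - by move=> y _; rewrite -EFinM lee_fin mulr_ge0.
  - by apply: measurable_funeM; apply/measurable_EFinP; exact: measurable_indic.
  rewrite ge0_integral_sum// ge0_integralZl_EFin//; last first.
    by apply/measurable_EFinP; exact: measurable_indic.
  by rewrite integral_indic// setIT.
have U : (\int[P]_y ((#|` S|%:R + 2 `^ r)%:E * f2 y + (2 `^ r * rho `^ r)%:E) =
          ((#|` S|%:R + 2 `^ r) * e + 2 `^ r * rho `^ r)%:E)%E.
  rewrite ge0_integralD//; last 3 first.
  - by move=> y _; rewrite mule_ge0.
  - exact: measurable_funeM.
  - by move=> y _; rewrite lee_fin mulr_ge0 ?powR_ge0.
  rewrite ge0_integralZl_EFin// [X in (_ * X)%E]eE.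
  by rewrite integral_cst_probability -EFinM -EFinD.
have : (\sum_(a <- S) \int[P]_y f1 a y + g%:E * P B <=
        ((#|` S|%:R + 2 `^ r) * e + 2 `^ r * rho `^ r)%:E)%E.
  rewrite -L -U; apply: le_lower_integral => // y _.
  - by rewrite adde_ge0 ?sume_ge0// -EFinM lee_fin mulr_ge0.
  - by rewrite adde_ge0 ?mule_ge0// lee_fin mulr_ge0 ?powR_ge0.
  rewrite /f1 /f2 sumEFin -!EFinM -!EFinD lee_fin.
  have := exchange_pointwise x y r0 b01 rho0 F0 Srho; rewrite -/D -/g -/B.
  by move=> /le_trans; apply; lra.
have : ((#|` S|%:R * e)%:E <= \sum_(a <- S) \int[P]_y f1 a y)%E.
  have -> : ((#|` S|%:R * e)%:E = \sum_(a <- S) e%:E)%E.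
    by rewrite sumEFin big_const_seq count_predT iter_addr addr0 mulr_natl.
  by rewrite big_seq [leRHS]big_seq; apply: lee_sum => a aS; exact: eS.
move=> /(leeD2r (g%:E * P B)%E) /le_trans /[apply].
have PBfin : P B \is a fin_num by exact: fin_num_measure.
rewrite -(fineK PBfin) -EFinM -EFinD lee_fin -/B; lra.
Qed.

End exchange.

(** * A one-dimensional grid whose gaps grow like a power *)

Section power_grid.
Context {R : realType}.

Lemma bernoulli_sub (a : R) k : 0 <= a <= 1 -> 1 - a ^+ k <= k%:R * (1 - a).
Proof.
case/andP => a0 a1; elim: k => [|k ih]; first by rewrite expr0 subrr mul0r.
have ak : a ^+ k <= 1 by rewrite exprn_ile1.
have ak0 : 0 <= a ^+ k by rewrite exprn_ge0.
rewrite exprS -natr1; nra.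
Qed.

(** The points (m / j)^k - 1 for 1 <= j <= m and their opposites: the images of
the uniform grid of ]0, 1] by a map whose derivative at the preimage of t has
the order of (1 + |t|)^(1 + 1/k). *)
Definition grid_pt (m k : nat) (i : bool * 'I_m) : R :=
  (-1) ^+ i.1 * ((m%:R / i.2.+1%:R) ^+ k - 1).

(** With 1 + |t| = (m / w)^k, the nearest grid point on the side of the origin
corresponds to an integer j in [w, w + 1], and the relative error
1 - (w / j)^k is at most k / w by Bernoulli's inequality. *)
Lemma grid_pt_near m k (t : R) : (0 < m)%N -> (0 < k)%N ->
  exists i, `|t - @grid_pt m k i| <= k%:R / m%:R * (1 + `|t|) `^ (1 + k%:R^-1) :> R.
Proof.
move=> m0 k0; have mR : 0 < m%:R :> R by rewrite ltr0n.
have kR : 0 < k%:R :> R by rewrite ltr0n.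
set T := 1 + `|t|; have T1 : 1 <= T by rewrite lerDl.
have T0 : 0 < T by apply: lt_le_trans T1.
pose Y := T `^ k%:R^-1; have Y0 : 0 < Y by rewrite powR_gt0.
have Yk : Y ^+ k = T.
  by rewrite -powR_mulrn ?ltW// -powRrM mulVf ?powRr1 ?ltW// gt_eqF.
have Y1 : 1 <= Y.
  by rewrite -[leLHS](powRr0 T) /Y; apply: ler_powR => //; rewrite invr_ge0 ltW.
(* w is the real index of |t| in the grid; rounding it up gives j.+1, except
   that rounding must not go beyond m when w = m. *)
pose w := m%:R / Y.
have w0 : 0 < w by rewrite divr_gt0.
have wm : w <= m%:R by rewrite ler_pdivrMr// ler_peMr// ltW.
have [j /andP[wj jw]] : exists j : 'I_m, w <= j.+1%:R <= w + 1.
  have tw : (Num.truncn w)%:R <= w by rewrite truncn_le ltW.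
  have wt := truncnS_gt w.
  have [tm|mt] := ltnP (Num.truncn w) m.
    by exists (Ordinal tm); rewrite (ltW wt)/= -natr1 lerD2r.
  have lm : (m.-1 < m)%N by rewrite prednK.
  exists (Ordinal lm) => /=; rewrite prednK// wm/=.
  by rewrite (@le_trans _ _ (Num.truncn w)%:R) ?ler_nat// (le_trans tw)// lerDl.
have j0 : 0 < j.+1%:R :> R by rewrite ltr0n.
exists (t < 0, j); rewrite /grid_pt /=.
set z := _ ^+ k - 1.
have -> : `|t - (-1) ^+ (t < 0)%R * z| = `|T - 1 - z|.
  have -> : T - 1 = `|t| by rewrite /T addrC addrA addNr add0r.
  have [tn|tn] := ltP t 0; last by rewrite expr0 mul1r (ger0_norm tn).
  by rewrite expr1 (ltr0_norm tn) -normrN; congr `|_|; ring.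
have Tw : T = (m%:R / w) ^+ k by rewrite -Yk /w invf_div mulrC divfK// gt_eqF.
have -> : T - 1 - z = T * (1 - (w / j.+1%:R) ^+ k).
  rewrite /z mulrBr mulr1 Tw -exprMn.
  have -> : m%:R / w * (w / j.+1%:R) = m%:R / j.+1%:R :> R.
    by field; rewrite !gt_eqF.
  by ring.
set a := w / _; have a0 : 0 <= a by rewrite divr_ge0// ltW.
have a1 : a <= 1 by rewrite ler_pdivrMr// mul1r.
have ak : a ^+ k <= 1 by rewrite exprn_ile1.
rewrite ger0_norm; last by rewrite mulr_ge0 ?subr_ge0// ltW.
have -> : T `^ (1 + k%:R^-1) = T * Y.
  rewrite powRD; first by rewrite powRr1// ltW.
  by apply/implyP => _; rewrite gt_eqF.
rewrite mulrCA ler_wpM2l ?(ltW T0)//.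
apply: (le_trans (bernoulli_sub k _)); first by rewrite a0.
rewrite -mulrA ler_wpM2l ?ler0n// [leRHS]mulrC -invf_div -/w.
have -> : 1 - a = (j.+1%:R - w) / j.+1%:R by rewrite /a; field; rewrite gt_eqF.
apply: (@le_trans _ _ (1 / j.+1%:R)).
  by rewrite ler_wpM2r ?invr_ge0 ?ler0n// lerBlDl.
by rewrite div1r lef_pV2.
Qed.

End power_grid.

(** * The optimal error is of order n^(-r/d) *)

Section optimal_error.
Context {R : realType} {d : nat} {N : 'rV[R]_d -> R}.
Hypothesis hN : is_norm N.
Hypothesis d_gt0 : (0 < d)%N.
Implicit Types (x y a : 'rV[R]_d) (F S : {fset 'rV[R]_d}).

Lemma card_le_fset F n : (#|` F| <= n)%N -> ([set` F] #<= `I_n)%card.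
Proof.
move=> Fn; have /card_eqPle[FI _] : ([set` F] #= `I_#|` F|)%card by apply/card_eq_fsetP.
by apply: (card_le_trans FI); rewrite card_le_II.
Qed.

Lemma card_le_fsetP (A : set 'rV[R]_d) n : (A #<= `I_n)%card ->
  exists2 F, A = [set` F] & (#|` F| <= n)%N.
Proof.
move=> An; have fA : finite_set A by apply/finite_set_leP; exists n.
by exists (fset_set A); [rewrite fset_setK|exact: geq_card_fset_set].
Qed.

(** The order of the distance between n points spread over a bounded region. *)
Definition mesh n : R := n%:R `^ (- d%:R^-1).

Lemma mesh_gt0 n : (0 < n)%N -> 0 < mesh n.
Proof. by move=> n0; rewrite powR_gt0 ?ltr0n. Qed.

Lemma mesh_le1 n : (0 < n)%N -> mesh n <= 1.
Proof.
move=> n0; rewrite -(powRr0 n%:R) /mesh; apply: ler_powR.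
  by rewrite ler1n.
by rewrite oppr_le0 invr_ge0 ler0n.
Qed.

Lemma mesh_expn n : (0 < n)%N -> mesh n ^+ d * n%:R = 1.
Proof.
move=> n0; have n0R : 0 < n%:R :> R by rewrite ltr0n.
rewrite -powR_mulrn ?powR_ge0// -powRrM mulNr mulVf; last by rewrite pnatr_eq0 -lt0n.
by rewrite powR_inv1 ?ltW// mulVf// gt_eqF.
Qed.

Lemma product_grid m k : (0 < m)%N -> (0 < k)%N ->
  exists F, [/\ [set` F] !=set0, (#|` F| <= (2 * m) ^ d)%N &
    forall x, exists2 a, a \in F &
      `|x - a| <= k%:R / m%:R * (1 + `|x|) `^ (1 + k%:R^-1)].
Proof.
move=> m0 k0.
pose pt (f : {ffun 'I_d -> bool * 'I_m}) : 'rV[R]_d := \row_i grid_pt k (f i).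
exists [fset pt f | f in {: {ffun 'I_d -> bool * 'I_m}}]%fset; split.
- exists (pt [ffun => (true, Ordinal m0)]); apply/imfsetP.
  by exists [ffun => (true, Ordinal m0)].
- apply: (leq_trans (leq_imfset_card _ _ _)).
  rewrite -cardE card_ffun card_prod card_bool !card_ord//.
- move=> x; have [f fP] := choice (fun i => grid_pt_near (x ord0 i) m0 k0).
  exists (pt [ffun i => f i]).
    by apply/imfsetP; exists [ffun i => f i].
  apply: mx_norm_leP; first by rewrite mulr_ge0 ?powR_ge0 ?divr_ge0.
  move=> i; rewrite !mxE ffunE (le_trans (fP i))// ler_wpM2l ?divr_ge0//.
  apply: ge0_ler_powR; rewrite ?nnegrE ?addr_ge0// ?invr_ge0//.
  by rewrite lerD2l coord_le_mx_norm.
Qed.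

Lemma moment_le (P : probability 'rV[R]_d R) (r p : R) : 0 <= r <= p ->
  (\int[P]_x (N x `^ p)%:E < +oo)%E -> (\int[P]_x (N x `^ r)%:E < +oo)%E.
Proof.
move=> /andP[r0 rp] mp.
apply: (@le_lt_trans _ _ (\int[P]_x (1%:E + (N x `^ p)%:E))%E).
  apply: le_lower_integral => // x _.
  - by rewrite lee_fin powR_ge0.
  - by rewrite adde_ge0// lee_fin powR_ge0.
  have Nx := norm_ge0 hN x; rewrite -EFinD lee_fin.
  have [N1|/ltW N1] := leP (N x) 1.
    rewrite ler_wpDr ?powR_ge0// -[leRHS](_ : 1 `^ r = 1); last by rewrite powR1.
    by rewrite ge0_ler_powR ?nnegrE.
  by rewrite ler_wpDl// ler_powR.
rewrite ge0_integralD//; last 2 first.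
- by move=> x _; rewrite lee_fin powR_ge0.
- exact: measurable_norm_powR.
by rewrite integral_cst_probability lte_add_pinfty// ltry.
Qed.

(** With k so large that r (1 + 1/k) <= r + delta, the error of the product grid
is at most a constant times m^(-r) times the moment of order r + delta. *)
Lemma quantizer_rate (P : probability 'rV[R]_d R) (r delta : R) :
    0 < r -> 0 < delta -> (\int[P]_x (N x `^ (r + delta))%:E < +oo)%E ->
  exists2 C : R, 0 < C & forall m, (0 < m)%N ->
    exists F, [/\ [set` F] !=set0, (#|` F| <= (2 * m) ^ d)%N &
      (quantization_error N P r [set` F] <= (C * (m%:R^-1) `^ r)%:E)%E].
Proof.
move=> r0 delta0 mom.
have [K K0 NK] := norm_ub hN; have [c c0 cN] := norm_lb hN.
pose k := (Num.truncn (r / delta)).+1.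
have k0 : 0 < k%:R :> R by rewrite ltr0n.
have rk : r * (1 + k%:R^-1) <= r + delta.
  rewrite mulrDr mulr1 lerD2l ler_pdivrMr// mulrC -ler_pdivrMr//.
  exact/ltW/truncnS_gt.
have p0 : 0 < r + delta by rewrite addr_gt0.
set p := r + delta in rk p0 mom *.
pose I := fine (\int[P]_x (N x `^ p)%:E)%E.
have I0 : (0 <= \int[P]_x (N x `^ p)%:E)%E.
  by apply: integral_ge0 => x _; rewrite lee_fin powR_ge0.
have IE : (\int[P]_x (N x `^ p)%:E = I%:E)%E.
  by rewrite fineK// ge0_fin_numE.
have I0' : 0 <= I by rewrite -lee_fin -IE.
pose A := (K * k%:R) `^ r * 2 `^ p.
have A0 : 0 < A by rewrite mulr_gt0// powR_gt0// mulr_gt0.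
exists (A * (1 + c^-1 `^ p * I)).
  by rewrite mulr_gt0// ltr_wpDr// mulr_ge0 ?powR_ge0.
move=> m m0; have mR : 0 < m%:R :> R by rewrite ltr0n.
have [F [F0 Fm Fx]] := product_grid m0 (ltn0Sn (Num.truncn (r / delta))).
exists F; split => //.
set B := A * m%:R^-1 `^ r.
have B0 : 0 <= B by rewrite mulr_ge0 ?powR_ge0// ltW.
have -> : (A * (1 + c^-1 `^ p * I) * m%:R^-1 `^ r)%:E =
   (\int[P]_x (B%:E + (B * c^-1 `^ p)%:E * (N x `^ p)%:E))%E.
  rewrite ge0_integralD//; last 2 first.
  - by move=> x _; rewrite -EFinM lee_fin !mulr_ge0 ?powR_ge0.
  - by apply: measurable_funeM; exact: measurable_norm_powR.
  rewrite integral_cst_probability ge0_integralZl_EFin//; last 3 first.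
  - by move=> x _; rewrite lee_fin powR_ge0.
  - exact: measurable_norm_powR.
  - by rewrite mulr_ge0 ?powR_ge0.
  by rewrite IE -EFinM -EFinD; congr EFin; rewrite /B; ring.
apply: le_lower_integral => // x _.
- by rewrite lee_fin powR_ge0.
- by rewrite -EFinM -EFinD lee_fin addr_ge0// !mulr_ge0 ?powR_ge0.
have [a aF xa] := Fx x.
have Nx := norm_ge0 hN x.
rewrite -EFinM -EFinD lee_fin.
have x1 : 1 <= 1 + `|x| by rewrite lerDl.
apply: (@le_trans _ _ ((K * k%:R * m%:R^-1 * (1 + `|x|) `^ (1 + k%:R^-1)) `^ r)).
  apply: ge0_ler_powR; rewrite ?nnegrE ?dist_set_ge0//; first exact: ltW.
    by rewrite !mulr_ge0 ?powR_ge0// ?invr_ge0 ltW.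
  apply: (le_trans (dist_set_le hN x aF)); apply: (le_trans (NK _)).
  by rewrite -!mulrA ler_pM2l// mulrA.
rewrite powRM ?powR_ge0//; last by rewrite !mulr_ge0// ?invr_ge0 ltW.
rewrite -powRrM powRM ?invr_ge0 ?ler0n//; last by rewrite mulr_ge0// ltW.
apply: (@le_trans _ _ ((K * k%:R) `^ r * m%:R^-1 `^ r *
    (2 `^ p * (1 `^ p + (c^-1 * N x) `^ p)))).
  rewrite ler_wpM2l ?mulr_ge0 ?powR_ge0//.
  apply: (@le_trans _ _ ((1 + `|x|) `^ p)).
    by apply: ler_powR; rewrite // mulrC.
  have cNx : `|x| <= c^-1 * N x by rewrite -ler_pdivrMl ?invr_gt0// invrK.
  have cN0 : 0 <= c^-1 * N x by apply: le_trans cNx.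
  apply: le_trans (powRD_le ler01 cN0 (ltW p0)).
  apply: ge0_ler_powR; rewrite ?nnegrE ?lerD2l ?addr_ge0//; exact: ltW.
rewrite powR1 (@powRM _ c^-1) ?invr_ge0 ?(ltW c0)//.
by rewrite le_eqVlt; apply/orP; left; apply/eqP; rewrite /B /A; ring.
Qed.

Lemma dist_set1 x a : dist_set N x [set a] = N (x - a).
Proof. by rewrite /dist_set image_set1 inf1. Qed.

(** Compare with the product grid for the largest m such that (2 m)^d <= n; for
the small n that have no such m, the quantizer {0} is enough. *)
Lemma optimal_error_rate (P : probability 'rV[R]_d R) (r delta : R)
    (alpha : nat -> set 'rV[R]_d) :
    0 < r -> 0 < delta -> (\int[P]_x (N x `^ (r + delta))%:E < +oo)%E ->
    (forall n, (1 <= n)%N -> is_optimal_quantizer N P r n (alpha n)) ->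
  exists2 C : R, 0 < C & forall n, (0 < n)%N ->
    (quantization_error N P r (alpha n) <= (C * mesh n `^ r)%:E)%E.
Proof.
move=> r0 delta0 mom opt.
have [C C0 CP] := quantizer_rate r0 delta0 mom.
have mr : (\int[P]_x (N x `^ r)%:E < +oo)%E.
  by apply: moment_le mom; rewrite (ltW r0) lerDl ltW.
pose I := fine (\int[P]_x (N x `^ r)%:E)%E.
have I0 : (0 <= \int[P]_x (N x `^ r)%:E)%E.
  by apply: integral_ge0 => x _; rewrite lee_fin powR_ge0.
have IE : (\int[P]_x (N x `^ r)%:E = I%:E)%E by rewrite fineK// ge0_fin_numE.
have I0' : 0 <= I by rewrite -lee_fin -IE.
exists (C * 4 `^ r + I * 2 `^ r).
  by rewrite ltr_wpDr ?mulr_ge0 ?powR_ge0// mulr_gt0 ?powR_gt0.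
move=> n n0; have [_ _ optn] := opt n n0.
set u := mesh n; have u0 : 0 < u := mesh_gt0 n0.
have [u2|u2] := leP (2 * u) 1; last first.
  have c1 : ([set 0%R : 'rV[R]_d] #<= `I_n)%card.
    rewrite -(set_fset1 (0%R : 'rV[R]_d)).
    by apply: card_le_fset; rewrite cardfs1.
  apply: (le_trans (optn [set 0%R] _ c1)); first by exists 0.
  rewrite /quantization_error; under eq_integral do rewrite dist_set1 subr0.
  rewrite IE lee_fin mulrDl ler_wpDl ?mulr_ge0 ?powR_ge0 ?(ltW C0)//.
  rewrite -mulrA -powRM ?(ltW u0)// ler_peMr// -[leLHS](_ : 1 `^ r = 1); last first.
    by rewrite powR1.
  by apply: ge0_ler_powR; rewrite ?nnegrE ?(ltW r0)// ltW// mulr_gt0.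
pose m := Num.truncn (2 * u)^-1.
have v0 : 0 <= (2 * u)^-1 by rewrite invr_ge0 mulr_ge0// ltW.
have m0 : (0 < m)%N by rewrite truncn_gt0 invf_ge1// mulr_gt0.
have mle : m%:R <= (2 * u)^-1 by rewrite truncn_le.
have mgt : (2 * u)^-1 < m%:R + 1 by rewrite natr1 truncnS_gt.
have mR : 0 < m%:R :> R by rewrite ltr0n.
have [F [F0 Fm FE]] := CP m m0.
have Fn : (#|` F| <= n)%N.
  apply: (leq_trans Fm); rewrite -(ler_nat R) natrX natrM.
  have -> : n%:R = u^-1 ^+ d.
    have ud : u ^+ d != 0 by rewrite expf_neq0// gt_eqF.
    by apply: (mulfI ud); rewrite (mesh_expn n0) exprVn mulfV.
  rewrite lerXn2r ?nnegrE ?invr_ge0 ?(ltW u0) ?mulr_ge0//.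
  by rewrite -ler_pdivlMl// -invfM.
apply: (le_trans (optn _ F0 (card_le_fset Fn))); apply: (le_trans FE).
rewrite lee_fin mulrDl ler_wpDr ?mulr_ge0 ?powR_ge0// -mulrA ler_pM2l//.
rewrite -powRM ?(ltW u0)//; apply: ge0_ler_powR;
  rewrite ?nnegrE ?invr_ge0 ?(ltW r0) ?mulr_ge0 ?(ltW u0)//.
rewrite -[leRHS]invrK lef_pV2 ?posrE ?invr_gt0 ?mulr_gt0//.
have -> : (4 * u)^-1 = (2 * u)^-1 / 2 by field; rewrite gt_eqF.
rewrite ler_pdivrMr// (le_trans (ltW mgt))// mulrDr mulr1 lerD2l.
by rewrite ler1n.
Qed.

End optimal_error.

(** * Lebesgue measure of balls, and mass outside small sets *)

Section lebesgue_ball.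
Context {R : realType} {d : nat} {N : 'rV[R]_d -> R}.
Hypothesis hN : is_norm N.
Implicit Types (x y a : 'rV[R]_d) (F S : {fset 'rV[R]_d}).

(** Half-open on the left, so that [lebesgue_rV_box] gives its measure. *)
Definition cube x (h : R) : set 'rV[R]_d :=
  [set v | forall i, v ord0 i \in `]x ord0 i - h, x ord0 i + h]].

Lemma measurable_cube x h : measurable (cube x h).
Proof.
have -> : cube x h = \bigcap_(i in [set: 'I_d])
    (fun v => v ord0 i) @^-1` `]x ord0 i - h, x ord0 i + h]%classic.
  by apply/seteqP; split=> [v vi i _|v vi i]; [exact: vi|exact: (vi i I)].
apply: fin_bigcap_measurable => [|i _]; first exact: finite_finset.
by rewrite -[X in measurable X]setTI; apply: measurable_coord_rV.
Qed.

Lemma lebesgue_cube x h : 0 <= h -> lebesgue_rV d (cube x h) = ((2 * h) ^+ d)%:E.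
Proof.
move=> h0; have := @lebesgue_rV_box R d (x - const_mx h) (x + const_mx h).
rewrite (_ : [set v | _] = cube x h); last first.
  by apply/seteqP; split=> v vi i; have := vi i; rewrite !mxE.
move=> ->; last by move=> i; rewrite !mxE; lra.
congr EFin; rewrite -[d in RHS]card_ord -prodr_const.
by apply: eq_bigr => i _; rewrite !mxE; ring.
Qed.

Lemma lebesgue_cball_ge : exists2 c : R, 0 < c &
  forall x t, 0 <= t -> ((c * t ^+ d)%:E <= lebesgue_rV d (cball N x t))%E.
Proof.
have [K K0 NK] := norm_ub hN.
exists ((2 / K) ^+ d); first by rewrite exprn_gt0// divr_gt0.
move=> x t t0; have h0 : 0 <= t / K by rewrite divr_ge0// ltW.
rewrite -exprMn mulrAC -mulrA -(lebesgue_cube x h0).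
apply: le_measure.
- exact: mem_set (measurable_cube x (t / K)).
- exact: mem_set (measurable_cball hN x t).
move=> y yx; rewrite /cball/=; apply: (le_trans (NK _)).
rewrite mulrC -ler_pdivlMr//; apply: mx_norm_leP => // i.
have := yx i; rewrite in_itv/= => /andP[y1 y2].
rewrite !mxE ler_norml; apply/andP; split; lra.
Qed.

Lemma lebesgue_cball_le : exists2 C : R, 0 < C &
  forall x t, 0 < t -> (lebesgue_rV d (cball N x t) <= (C * t ^+ d)%:E)%E.
Proof.
have [k k0 kN] := norm_lb hN.
(* The factor 4 is twice the half-width 2 t / k: the half-width t / k would
   not do, as the cube lacks its left faces. *)
exists ((4 / k) ^+ d); first by rewrite exprn_gt0// divr_gt0.
move=> x t t0; have h0 : 0 < t / k by rewrite divr_gt0.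
have -> : (4 / k) ^+ d * t ^+ d = (2 * (2 * (t / k))) ^+ d.
  by rewrite -exprMn; congr (_ ^+ _); field; rewrite gt_eqF.
rewrite -(lebesgue_cube x); last by rewrite mulr_ge0// ltW.
apply: le_measure.
- exact: mem_set (measurable_cball hN x t).
- exact: mem_set (measurable_cube _ _).
move=> y yx i.
have xy : `|(x - y) ord0 i| <= t / k.
  rewrite (le_trans (coord_le_mx_norm _ _))// ler_pdivlMr// mulrC.
  exact: le_trans (kN _) yx.
move: xy; rewrite !mxE ler_norml in_itv/= => /andP[y1 y2].
by apply/andP; split; lra.
Qed.

End lebesgue_ball.

Section absolute_continuity.
Context {R : realType} {d : nat} {N : 'rV[R]_d -> R}.
Hypothesis hN : is_norm N.
Implicit Types (x y a : 'rV[R]_d) (F S : {fset 'rV[R]_d}).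

(** The epsilon-delta form of absolute continuity for a finite measure. *)
Lemma dominates_small_sets dT (T : measurableType dT) (mu nu : {measure set T -> \bar R}) :
  (nu setT < +oo)%E -> nu `<< mu -> forall e : R, 0 < e ->
  exists2 del : R, 0 < del & forall A, measurable A ->
    (mu A < del%:E)%E -> (nu A < e%:E)%E.
Proof.
move=> nuT numu e e0.
pose nu' : {finite_measure set T -> \bar R} := mfrestr measurableT nuT.
have nuE A : nu' A = nu A by rewrite /nu' /= /mfrestr /mrestr/= setIT.
have numu' : nu' `<< mu.
  apply/null_content_dominatesP => A mA muA0; rewrite nuE.
  by move/null_content_dominatesP : numu; exact.
have [Q [M QM]] := Hahn_decomposition (charge_of_finite_measure nu').
have [del [del0 delP]] := @charge_variation_continuous _ _ _ _ _ _ QM mu numu' e e0.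
exists del => // A mA muA; rewrite -nuE.
apply: le_lt_trans (delP A mA muA).
apply: (le_trans _ (abse_charge_variation QM mA)).
exact: lee_abs.
Qed.

(** A ball charged by the absolutely continuous part keeps half of that charge
outside any set of small Lebesgue measure. *)
Lemma ac_part_mass (P : probability 'rV[R]_d R)
    (Pa : {measure set 'rV[R]_d -> \bar R}) :
    is_ac_part (lebesgue_rV d) P Pa ->
    (exists2 A, measurable A & Pa A != 0%E) ->
  exists eta del L : R, [/\ 0 < eta, 0 < del, 0 <= L &
    forall A, measurable A -> (lebesgue_rV d A < del%:E)%E ->
      (eta%:E <= P (cball N 0 L `\` A))%E].
Proof.
move=> [Pa_leb [Ps _ PE]] [A0 mA0 A0_neq0].
have PaP A : measurable A -> (Pa A <= P A)%E.
  by move=> mA; rewrite PE// leeDl.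
have Pafin A : measurable A -> Pa A \is a fin_num.
  move=> mA; rewrite ge0_fin_numE//; apply: (le_lt_trans (PaP _ mA)).
  by rewrite -ge0_fin_numE//; exact: fin_num_measure.
have mB L : measurable (cball N 0 L) := measurable_cball hN _ _.
have [k Pk] : exists k : nat, Pa (cball N 0 k%:R) != 0%E.
  apply: contrapT => /forallNP h.
  have : Pa (\bigcup_(k : nat) cball N 0 k%:R) = 0%E.
    apply/eqP; rewrite eq_le measure_ge0 andbT.
    apply: (@le_trans _ _ (\sum_(0 <= i <oo) Pa (cball N 0 i%:R))%E).
      by apply: generalized_Boole_inequality => //; exact: bigcup_measurable.
    rewrite eseries0// => i _ _; apply/eqP/negPn/negP; exact: h.
  move=> U0; move/negP: A0_neq0; apply; rewrite eq_le measure_ge0 andbT -U0.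
  apply: le_measure; [exact: mem_set|by apply: mem_set; exact: bigcup_measurable|].
  move=> x _; exists (Num.truncn (N x)).+1 => //.
  by rewrite /cball/= sub0r (normN hN) ltW// truncnS_gt.
pose B := cball N 0 k%:R; have mBk : measurable B := mB _.
have B0 : 0 < fine (Pa B).
  rewrite fine_gt0//; apply/andP; split; first by rewrite lt0e Pk measure_ge0.
  by rewrite -ge0_fin_numE//; exact: Pafin _ (mB _).
have PaT : (Pa setT < +oo)%E by rewrite -ge0_fin_numE//; exact: Pafin.
have [del del0 delP] := dominates_small_sets PaT Pa_leb (divr_gt0 B0 (ltr0n _ 2)).
exists (fine (Pa B) / 2), del, k%:R; split => //; first by rewrite divr_gt0.
move=> A mA /(delP A mA) PaA.
have mBA : measurable (B `\` A) by exact: measurableD.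
apply: le_trans (PaP _ mBA).
have : (Pa B <= Pa (B `\` A) + Pa A)%E.
  apply: le_trans (measureU2 _ _ _) => //.
  apply: le_measure; [exact: mem_set|apply: mem_set; exact: measurableU|].
  by move=> x Bx; have [Ax|nAx] := pselect (A x); [right|left].
move: PaA; rewrite -(fineK (Pafin _ mBA)) -(fineK (Pafin _ mA)).
rewrite -[in X in X -> _ -> _](fineK (Pafin _ (mB _))).
rewrite -[X in (X <= _ + _)%E](fineK (Pafin _ (mB _))).
rewrite -EFinD !lee_fin lte_fin -/B; lra.
Qed.

End absolute_continuity.

(** * Optimal quantizers have many close centers in a bounded region *)

Section packing.
Context {R : realType} {d : nat} {N : 'rV[R]_d -> R}.
Hypothesis hN : is_norm N.
Hypothesis d_gt0 : (0 < d)%N.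
Implicit Types (x y a : 'rV[R]_d) (F S : {fset 'rV[R]_d}).
Local Notation mesh := (@mesh R d).

(** A cubical partition of side comparable to rho, presented by the map g that
sends a point to its cell. *)
Lemma finite_cells (L rho0 : R) : 0 <= L -> 0 < rho0 ->
  exists2 C : R, 0 < C & forall rho, 0 < rho <= rho0 ->
    exists (T : finType) (g : 'rV[R]_d -> T), #|T|%:R * rho ^+ d <= C /\
      forall x y, N x <= L -> N y <= L -> g x = g y -> N (x - y) <= rho.
Proof.
move=> L0 rho0_gt0.
have [K K0 NK] := norm_ub hN; have [k k0 kN] := norm_lb hN.
pose L' := L / k; have L'0 : 0 <= L' by rewrite divr_ge0// ltW.
have LN x i : N x <= L -> `|x ord0 i| <= L'.
  move=> xL; rewrite (le_trans (coord_le_mx_norm _ _))// ler_pdivlMr// mulrC.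
  exact: le_trans (kN _) xL.
exists ((2 * L' * K + rho0) ^+ d).
  by rewrite exprn_gt0// ltr_wpDl// mulr_ge0 ?(ltW K0)// mulr_ge0.
move=> rho /andP[rho_gt0 rho_le].
pose h := rho / K; have h0 : 0 < h by rewrite divr_gt0.
pose M := Num.truncn (2 * L' / h).
pose pos x i := (x ord0 i + L') / h.
have pos0 x i : N x <= L -> 0 <= pos x i.
  by move=> /LN - /(_ i); rewrite ler_norml => /andP[? _]; rewrite divr_ge0 ?(ltW h0)//; lra.
have posM x i : N x <= L -> (Num.truncn (pos x i) < M.+1)%N.
  move=> /LN - /(_ i); rewrite ler_norml => /andP[_ ?]; rewrite ltnS.
  by apply: le_truncn; rewrite ler_wpM2r ?invr_ge0 ?(ltW h0)//; lra.
exists {ffun 'I_d -> 'I_M.+1}.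
exists (fun x => [ffun i => inord (Num.truncn (pos x i))]); split.
  rewrite card_ffun !card_ord natrX -exprMn.
  apply: lerXn2r; rewrite ?nnegrE; first by rewrite mulr_ge0 ?ler0n ?ltW.
    by rewrite addr_ge0 ?(ltW rho0_gt0)// mulr_ge0 ?(ltW K0)// mulr_ge0.
  have Mle : M%:R <= 2 * L' / h by rewrite truncn_le divr_ge0 ?(ltW h0)// mulr_ge0.
  rewrite -natr1 mulrDl mul1r lerD//.
  have -> : 2 * L' * K = 2 * L' / h * rho.
    by rewrite /h; field; rewrite !gt_eqF.
  by rewrite ler_wpM2r// ltW.
move=> x y xL yL gxy; apply: (le_trans (NK _)).
have -> : rho = K * h by rewrite /h mulrC divfK// gt_eqF.
rewrite ler_wpM2l ?(ltW K0)//; apply: mx_norm_leP; first exact: ltW.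
move=> i; have /(congr1 (@nat_of_ord _)) := congr1 (fun f : {ffun _} => f i) gxy.
rewrite !ffunE !inordK ?posM// => tE.
have /andP[x1 x2] := truncn_itv (pos0 x i xL).
have /andP[y1 y2] := truncn_itv (pos0 y i yL).
have -> : (x - y) ord0 i = (pos x i - pos y i) * h.
  by rewrite !mxE /pos; field; rewrite gt_eqF.
rewrite normrM (gtr0_norm h0) ler_piMl// ?(ltW h0)//.
move: x1 x2; rewrite tE -natr1 => x1 x2; move: y2; rewrite -natr1 => y2.
by rewrite ler_norml; apply/andP; split; lra.
Qed.

(** If few centers were in the ball, their neighborhoods of radius kap * mesh
would have small Lebesgue measure, and a fixed mass would lie at distance at
least kap * mesh from the quantizer. For kap large this contradicts the rate
of the error. *)
Lemma many_bounded_centers (P : probability 'rV[R]_d R)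
    (Pa : {measure set 'rV[R]_d -> \bar R}) (r C : R) :
    is_ac_part (lebesgue_rV d) P Pa ->
    (exists2 A, measurable A & Pa A != 0%E) -> 0 < r -> 0 < C ->
  exists c kap L : R, [/\ 0 < c, 0 < kap, 0 <= L &
    forall n F, (0 < n)%N -> kap * mesh n <= 1 -> [set` F] !=set0 ->
      (quantization_error N P r [set` F] <= (C * mesh n `^ r)%:E)%E ->
      c <= #|` [fset a in F | N a <= L]%fset|%:R * mesh n ^+ d].
Proof.
move=> Pac Pa0 r0 C0.
have [eta [del [L [eta0 del0 L0 mass]]]] := ac_part_mass hN Pac Pa0.
have [C2 C20 leb] := lebesgue_cball_le hN.
pose kap := (2 * C / eta) `^ r^-1.
have kap0 : 0 < kap by rewrite powR_gt0// divr_gt0// mulr_gt0.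
have kapr : kap `^ r = 2 * C / eta.
  rewrite /kap -powRrM mulVf ?powRr1 ?gt_eqF//.
  by rewrite divr_ge0 ?mulr_ge0// ltW.
exists (del / (C2 * kap ^+ d)), kap, (L + 1); split => //.
- by rewrite divr_gt0// mulr_gt0// exprn_gt0.
- by rewrite addr_ge0.
move=> n F n0 kapu F0 err; set u := mesh n; set S := [fset a in F | _]%fset.
have u0 : 0 < u := mesh_gt0 n0.
rewrite leNgt; apply/negP => Su.
pose e := kap * u; have e0 : 0 < e by rewrite mulr_gt0.
pose A := \bigcup_(a in [set` S]) cball N a e.
have finS : finite_set [set` S] by exact: finite_fset.
have mA : measurable A.
  by apply: fin_bigcup_measurable => // a _; exact: measurable_cball.
have lebA : (lebesgue_rV d A < del%:E)%E.
  apply: (@le_lt_trans _ _ (\sum_(a \in [set` S]) lebesgue_rV d (cball N a e))%E).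
    by apply: content_sub_fsum => // a _; exact: measurable_cball.
  rewrite fsbig_finite//= set_fsetK.
  apply: (@le_lt_trans _ _ (\sum_(a <- S) (C2 * e ^+ d)%:E)%E).
    by apply: lee_sum => a _; exact: leb.
  rewrite sumEFin big_const_seq count_predT iter_addr addr0 lte_fin.
  move: Su; rewrite ltr_pdivlMr ?mulr_gt0 ?exprn_gt0//.
  by rewrite /e exprMn -mulr_natl; congr (_ < _); ring.
have {}mass := mass A mA lebA.
have mBA : measurable (cball N 0 L `\` A).
  by apply: measurableD => //; exact: measurable_cball.
have : ((e `^ r * eta)%:E <= quantization_error N P r [set` F])%E.
  apply: (@le_trans _ _ ((e `^ r)%:E * P (cball N 0 L `\` A))%E).
    by rewrite EFinM lee_wpmul2l// lee_fin powR_ge0.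
  rewrite -integral_cst//; apply: le_lower_integral => // y.
  - by rewrite lee_fin powR_ge0.
  - by rewrite lee_fin powR_ge0.
  rewrite /cball/= sub0r (normN hN) => -[yL yA]; rewrite lee_fin.
  apply: ge0_ler_powR; rewrite ?nnegrE ?dist_set_ge0 ?(ltW r0) ?(ltW e0)//.
  apply: le_dist_set => // a aF.
  have [aL|aL] := leP (N a) (L + 1).
    rewrite leNgt; apply/negP => yae; apply: yA; exists a.
      by rewrite /S /= !inE; apply/andP.
    by rewrite /cball/= (norm_distC hN) ltW.
  (* A center outside the ball of radius L + 1 is at distance at least 1 from y. *)
  apply: (le_trans kapu); have := normD hN (a - y) y.
  by rewrite subrK (norm_distC hN); lra.
move=> /le_trans/(_ err); rewrite lee_fin /e powRM ?(ltW kap0) ?(ltW u0)// kapr.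
have ur : 0 < u `^ r by rewrite powR_gt0.
have -> : 2 * C / eta * u `^ r * eta = 2 * (C * u `^ r) by field; rewrite gt_eqF.
have : 0 < C * u `^ r by rewrite mulr_gt0.
rewrite -/u; lra.
Qed.

Lemma leq_card_inj_in (T : finType) (A : {fset 'rV[R]_d}) (g : 'rV[R]_d -> T) :
  {in A &, injective g} -> (#|` A| <= #|T|)%N.
Proof.
move=> gi; rewrite -(size_map g) cardE; apply: uniq_leq_size.
  by rewrite map_inj_in_uniq ?fset_uniq.
by move=> t _; rewrite mem_enum.
Qed.

(** Isolated points lie in distinct cells, so they are at most as many as the
cells, which is half the number of points once kap is large enough. *)
Lemma many_close_centers (L c : R) : 0 <= L -> 0 < c ->
  exists2 kap : R, 0 < kap & forall n S, (0 < n)%N -> kap * mesh n <= 1 ->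
    (forall a, a \in S -> N a <= L) -> c <= #|` S|%:R * mesh n ^+ d ->
    exists2 S', (S' `<=` S)%fset & c / 2 <= #|` S'|%:R * mesh n ^+ d /\
      forall a, a \in S' -> exists2 a', a' \in S &
        a' != a /\ N (a - a') <= kap * mesh n.
Proof.
move=> L0 c0.
have [C C0 cells] := finite_cells L0 (@ltr01 R).
pose q := 2 * C / c; have q0 : 0 < q by rewrite divr_gt0// mulr_gt0.
pose kap := q `^ d%:R^-1; have kap0 : 0 < kap by rewrite powR_gt0.
have kapd : kap ^+ d = q.
  rewrite -powR_mulrn ?(ltW kap0)// -powRrM mulVf ?powRr1 ?(ltW q0)//.
  by rewrite pnatr_eq0 -lt0n.
exists kap => // n S n0 kapu SL cS; set u := mesh n.
have u0 : 0 < u := mesh_gt0 n0.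
have [|T [g [Tle gN]]] := cells (kap * u); first by rewrite mulr_gt0.
pose close a := [exists c : S, (val c != a) && (N (a - val c) <= kap * u)].
pose S' := [fset a in S | close a]%fset; pose S2 := [fset a in S | ~~ close a]%fset.
exists S'; first by apply/fsubsetP => a; rewrite !inE => /andP[].
split; last first.
  move=> a; rewrite !inE => /andP[_ /existsP[[a' a'S] /andP[? ?]]].
  by exists a'.
have S2T : (#|` S2| <= #|T|)%N.
  apply: (@leq_card_inj_in T S2 g) => a a' /=; rewrite !inE.
  move=> /andP[aS /negP aC] /andP[a'S _] gaa'.
  apply: contrapT => /eqP aa'; apply: aC; apply/existsP; exists [` a'S]%fset.
  by rewrite /= eq_sym aa' gN//; exact: SL.
have SS : (#|` S| <= #|` S'| + #|` S2|)%N.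
  rewrite -cardfsUI; apply: leq_trans (leq_addr _ _).
  apply: fsubset_leq_card; apply/fsubsetP => a aS.
  by rewrite !inE aS /= orbN.
have ud0 : 0 < u ^+ d by rewrite exprn_gt0.
have : #|` S2|%:R * u ^+ d <= c / 2.
  have : #|T|%:R * (kap * u) ^+ d <= C := Tle.
  rewrite exprMn kapd mulrA -ler_pdivlMr// => h.
  rewrite -ler_pdivlMr//; apply: (@le_trans _ _ #|T|%:R); first by rewrite ler_nat.
  rewrite -(ler_pM2r q0); apply: (le_trans h).
  by rewrite le_eqVlt; apply/orP; left; apply/eqP; rewrite /q; field; rewrite !gt_eqF.
move: SS; rewrite -(ler_nat R) natrD -(ler_pM2r ud0) mulrDl => SS.
move: cS; rewrite -/u; lra.
Qed.

End packing.

(** * The micro-macro inequality *)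

Section micro_macro.
Context {R : realType} {d : nat} {N : 'rV[R]_d -> R}.
Hypothesis hN : is_norm N.
Hypothesis d_gt0 : (0 < d)%N.
Implicit Types (x y a : 'rV[R]_d) (F S : {fset 'rV[R]_d}) (A : set 'rV[R]_d).
Local Notation mesh := (@mesh R d).

Lemma mesh_powRD n r : (0 < n)%N -> mesh n `^ (d%:R + r) = mesh n ^+ d * mesh n `^ r.
Proof.
move=> n0; have u0 := mesh_gt0 n0 : 0 < mesh n.
rewrite powRD ?powR_mulrn ?(ltW u0)//.
by apply/implyP => _; rewrite gt_eqF.
Qed.

(** Restrict the error integral to the ball: a crude form of the micro-macro
inequality, used for the finitely many n too small for the exchange. *)
Lemma local_error_le (P : probability 'rV[R]_d R) A x (b r : R) :
    0 < r -> 0 < b < 1 / 2 -> A !=set0 ->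
  let D := dist_set N x A in
  (((1 - b) `^ r * (D `^ r * fine (P (cball N x (b * D)))))%:E <=
    quantization_error N P r A)%E.
Proof.
move=> r0 /andP[b0 b12] A0; set D := dist_set N x A; rewrite /=.
have D0 : 0 <= D := dist_set_ge0 hN _ _.
have b1 : 0 <= 1 - b by lra.
have mB := measurable_cball hN x (b * D).
rewrite mulrA -powRM// EFinM fineK; last exact: fin_num_measure.
rewrite -integral_cst//; apply: le_lower_integral => // y.
- by rewrite lee_fin powR_ge0.
- by rewrite lee_fin powR_ge0.
rewrite /cball/= => xy; rewrite lee_fin.
apply: ge0_ler_powR; rewrite ?nnegrE ?dist_set_ge0 ?mulr_ge0 ?(ltW r0)//.
rewrite mulrBl mul1r lerBlDl.
by apply: (le_trans (dist_set_tri hN _ y A0)); rewrite lerD2r.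
Qed.

(** [exchange] applied to the centers that have a close neighbor. Their number
times mesh^d is bounded below, and both the error and rho^r are O(mesh^r); a
large mesh, that is, a small n, is absorbed into the constant. *)
Lemma micro_macro (r delta b : R) (P : probability 'rV[R]_d R)
    (Pa : {measure set 'rV[R]_d -> \bar R}) (alpha : nat -> set 'rV[R]_d) :
    0 < r -> 0 < delta -> 0 < b < 1 / 2 ->
    is_ac_part (lebesgue_rV d) P Pa ->
    (exists2 A, measurable A & Pa A != 0%E) ->
    (\int[P]_x (N x `^ (r + delta))%:E < +oo)%E ->
    (forall n, (1 <= n)%N -> is_optimal_quantizer N P r n (alpha n)) ->
  exists2 C : R, 0 < C & forall n x, (0 < n)%N ->
    let D := dist_set N x (alpha n) in
    D `^ r * fine (P (cball N x (b * D))) <= C * mesh n `^ (d%:R + r).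
Proof.
move=> r0 delta0 b01 Pac Pa0 mom opt; have /andP[b0 b12] := b01.
have [C1 C10 rate] := optimal_error_rate hN d_gt0 r0 delta0 mom opt.
have [c [kap1 [L [c0 kap10 L0 bounded]]]] :=
  many_bounded_centers hN Pac Pa0 r0 C10.
have [kap2 kap20 close] := many_close_centers hN d_gt0 L0 c0.
have g0 : 0 < (1 - b) `^ r - b `^ r.
  by rewrite subr_gt0; apply: gt0_ltr_powR; rewrite ?nnegrE//; lra.
have b1r : 0 < (1 - b) `^ r by rewrite powR_gt0//; lra.
set g := _ - _ in g0.
pose A1 := 2 `^ r * (C1 + kap2 `^ r) / (c / 2 * g).
pose kap := kap1 + kap2; have kap0 : 0 < kap by rewrite addr_gt0.
pose A2 := C1 * kap ^+ d / (1 - b) `^ r.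
have A10 : 0 < A1.
  by rewrite divr_gt0// mulr_gt0 ?powR_gt0 ?divr_gt0// ltr_wpDr ?powR_ge0.
have A20 : 0 < A2 by rewrite divr_gt0// mulr_gt0// exprn_gt0.
exists (A1 + A2); first by rewrite addr_gt0.
move=> n x n0; set D := dist_set N x _; rewrite /=.
set X := _ * _.
set u := mesh n; have u0 : 0 < u := mesh_gt0 n0.
have [al0 aln optn] := opt n n0; have errn := rate n n0.
have udr : 0 < u `^ (d%:R + r) by rewrite powR_gt0.
have [kapu|kapu] := leP (kap * u) 1; last first.
  apply: (@le_trans _ _ (A2 * u `^ (d%:R + r))); last by rewrite ler_pM2r// lerDr ltW.
  have := le_trans (local_error_le P x r0 b01 al0) errn.
  rewrite /= -/D -/X lee_fin -/u => h.
  rewrite /A2 mulrAC ler_pdivlMr// mulrC (le_trans h)//.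
  rewrite -mulrA ler_pM2l// mesh_powRD// mulrA ler_peMl ?powR_ge0//.
  by rewrite -exprMn exprn_ege1// ltW.
apply: (@le_trans _ _ (A1 * u `^ (d%:R + r))); last by rewrite ler_pM2r// lerDl ltW.
have [F FE Fn] := card_le_fsetP aln.
have ku1 : kap1 * u <= 1.
  by apply: le_trans kapu; rewrite ler_pM2r// lerDl ltW.
have ku2 : kap2 * u <= 1.
  by apply: le_trans kapu; rewrite ler_pM2r// lerDr ltW.
rewrite FE in al0 errn optn.
have cS := bounded n F n0 ku1 al0 errn.
set S := [fset a in F | _]%fset in cS.
have SL a : a \in S -> N a <= L by rewrite !inE => /andP[].
have [S' S'S [cS' S'close]] := close n S n0 ku2 SL cS.
have SF a : a \in S -> a \in F by rewrite !inE => /andP[].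
have S'F a : a \in S' -> a \in F by move=> aS'; apply: SF; exact: (fsubsetP S'S).
have finE : quantization_error N P r [set` F] \is a fin_num.
  rewrite ge0_fin_numE ?quantization_error_ge0//.
  by apply: (le_lt_trans errn); rewrite ltry.
set e := fine (quantization_error N P r [set` F]).
have eE : quantization_error N P r [set` F] = e%:E by rewrite fineK.
have rho0 : 0 <= kap2 * u by rewrite mulr_ge0// ltW.
have S'rho a : a \in S' ->
    exists2 a', a' \in F & a' != a /\ N (a - a') <= kap2 * u.
  by move=> /S'close[a' a'S ?]; exists a' => //; exact: SF.
have eswap a : a \in S' ->
    (e%:E <= quantization_error N P r [set` swap F a x])%E.
  move=> aS'; rewrite -eE; apply: optn; first exact: swap_neq0.
  apply: card_le_fset; apply: leq_trans Fn; apply: card_swap; exact: S'F.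
have := exchange hN r0 b01 rho0 al0 S'rho eE eswap.
rewrite /= -FE -/D -/g -mulrA -/X => h.
have X0 : 0 <= X by rewrite mulr_ge0 ?powR_ge0// fine_ge0.
have eC : e <= C1 * u `^ r by rewrite -lee_fin -eE.
have ud0 : 0 < u ^+ d by rewrite exprn_gt0.
have {}h : #|` S'|%:R * g * X <= 2 `^ r * (C1 + kap2 `^ r) * u `^ r.
  apply: (le_trans h); rewrite -mulrA ler_wpM2l ?powR_ge0// mulrDl.
  by rewrite powRM ?(ltW kap20) ?(ltW u0)// lerD2r.
rewrite /A1 mulrAC ler_pdivlMr; last by rewrite !mulr_gt0.
rewrite mesh_powRD// -/u [leRHS]mulrCA.
apply: (@le_trans _ _ (u ^+ d * (#|` S'|%:R * g * X))); last by rewrite ler_pM2l.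
have -> : u ^+ d * (#|` S'|%:R * g * X) = X * (#|` S'|%:R * u ^+ d * g) by ring.
by rewrite ler_wpM2l// ler_pM2r.
Qed.

(** D(0)^r <= 2^r (||x||^r + D(x)^r) for every x; integrate over x. *)
Lemma dist0_bounded (r C : R) (P : probability 'rV[R]_d R)
    (alpha : nat -> set 'rV[R]_d) :
    0 < r -> 0 < C -> (\int[P]_x (N x `^ r)%:E < +oo)%E ->
    (forall n, (0 < n)%N -> alpha n !=set0) ->
    (forall n, (0 < n)%N ->
      (quantization_error N P r (alpha n) <= (C * mesh n `^ r)%:E)%E) ->
  exists2 M : R, 0 <= M & forall n, (0 < n)%N -> dist_set N 0 (alpha n) <= M.
Proof.
move=> r0 C0 mr al0 rate.
pose I := fine (\int[P]_x (N x `^ r)%:E)%E.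
have I0 : (0 <= \int[P]_x (N x `^ r)%:E)%E.
  by apply: integral_ge0 => x _; rewrite lee_fin powR_ge0.
have IE : (\int[P]_x (N x `^ r)%:E = I%:E)%E by rewrite fineK// ge0_fin_numE.
pose Q := 2 `^ r * (I + C).
exists (Q `^ r^-1); first exact: powR_ge0.
move=> n n0; set D := dist_set N 0 _.
have D0 : 0 <= D := dist_set_ge0 hN _ _.
suff DQ : D `^ r <= Q.
  rewrite -[leLHS](powRr1 D0) -[1](mulfV (lt0r_neq0 r0)) powRrM.
  apply: ge0_ler_powR; rewrite ?nnegrE ?powR_ge0 ?invr_ge0 ?(ltW r0)//.
  by apply: le_trans DQ; exact: powR_ge0.
have mD := measurable_dist_set hN r (al0 n n0).
have mNr := measurable_norm_powR hN r.
have c0 : 0 <= 2 `^ r :> R := powR_ge0 _ _.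
have : ((D `^ r)%:E <= (2 `^ r)%:E *
    (\int[P]_x (N x `^ r)%:E + quantization_error N P r (alpha n)))%E.
  rewrite -ge0_integralD//; last 2 first.
  - by move=> x _; rewrite lee_fin powR_ge0.
  - by move=> x _; rewrite lee_fin powR_ge0.
  rewrite -ge0_integralZl_EFin//; last 2 first.
  - by move=> x _; rewrite -EFinD lee_fin addr_ge0 ?powR_ge0.
  - exact: emeasurable_funD.
  rewrite -(integral_cst_probability P); apply: le_lower_integral => // x _.
  - by rewrite lee_fin powR_ge0.
  - by rewrite -EFinD -EFinM lee_fin mulr_ge0 ?addr_ge0 ?powR_ge0.
  rewrite -EFinD -EFinM lee_fin.
  apply: le_trans (powRD_le (norm_ge0 hN x) (dist_set_ge0 hN x (alpha n)) (ltW r0)).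
  apply: ge0_ler_powR; rewrite ?nnegrE ?addr_ge0 ?dist_set_ge0 ?(norm_ge0 hN) ?(ltW r0)//.
  apply: (le_trans (dist_set_tri hN 0 x (al0 n n0))).
  by rewrite sub0r (normN hN).
rewrite IE -lee_fin => /le_trans; apply.
rewrite /Q EFinM EFinD; apply: lee_wpmul2l; first by rewrite lee_fin.
apply: leeD2l; apply: (le_trans (rate n n0)); rewrite lee_fin ler_piMr ?(ltW C0)//.
rewrite -[leRHS](_ : 1 `^ r = 1); last by rewrite powR1.
have u0 := mesh_gt0 n0 : 0 < mesh n.
apply: ge0_ler_powR; rewrite ?nnegrE ?(ltW r0) ?(ltW u0)//; exact: mesh_le1.
Qed.

End micro_macro.

(** * The mismatched error inside a ball *)

Section inner_outer.
Context {R : realType} {d : nat} {N : 'rV[R]_d -> R}.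
Hypothesis hN : is_norm N.
Variable P : probability 'rV[R]_d R.
Implicit Types (x y a : 'rV[R]_d) (A : set 'rV[R]_d).

(** The conclusion of [micro_macro], as a property of a quantizer A. *)
Definition local_bound (b r E : R) A := forall x,
  let D := dist_set N x A in D `^ r * fine (P (cball N x (b * D))) <= E.

Lemma measurable_far A M tau : A !=set0 ->
  measurable (cball N 0 M `&` [set x | tau < dist_set N x A]).
Proof.
move=> A0; apply: measurableI; first exact: measurable_cball.
have -> : [set x | tau < dist_set N x A] =
    [set: 'rV[R]_d] `&` (fun x => dist_set N x A) @^-1` `]tau, +oo[.
  by apply/seteqP; split=> [x|x [_]]; rewrite /= in_itv/= andbT.
exact: measurable_dist.
Qed.

(** Two points of one cell of diameter b tau, both at distance more than tau
from A, are in the ball of radius b D around each other. So each cell carries at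
most E / tau^r, and there are O(tau^(-d)) cells. *)
Lemma weak_type (b r M D0 : R) : 0 < b -> 0 < r -> 0 <= M -> 0 < D0 ->
  exists2 C : R, 0 < C & forall A E tau, A !=set0 -> local_bound b r E A ->
    0 < tau <= D0 ->
    fine (P (cball N 0 M `&` [set x | tau < dist_set N x A])) <=
      C * E / tau `^ (d%:R + r).
Proof.
move=> b0 r0 M0 D00.
have [C C0 cells] := finite_cells hN M0 (mulr_gt0 b0 D00).
have bd0 : 0 < b ^+ d by rewrite exprn_gt0.
exists (C / b ^+ d); first by rewrite divr_gt0.
move=> A E tau A0 AE /andP[tau0 tauD]; set W := _ `&` _.
have mW : measurable W := measurable_far M tau A0.
have [|T [g [Tle gN]]] := cells (b * tau); first by rewrite mulr_gt0//= ler_pM2l.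
have taur : 0 < tau `^ r by rewrite powR_gt0.
have /choice[B BP] : forall t, exists Bt : set 'rV[R]_d, [/\ measurable Bt,
    (P Bt <= (E / tau `^ r)%:E)%E & forall x, W x -> g x = t -> Bt x].
  move=> t.
  have [[x [Wx gx]]|nx] := pselect (exists x, W x /\ g x = t); last first.
    exists set0; split; [exact: measurable0| |].
      rewrite measure0 lee_fin divr_ge0 ?powR_ge0//.
      apply: le_trans (AE 0); rewrite mulr_ge0 ?powR_ge0 ?fine_ge0//.
    by move=> x Wx gx; case: nx; exists x.
  have [xM xtau] := Wx.
  have mB := measurable_cball hN x (b * dist_set N x A).
  exists (cball N x (b * dist_set N x A)); split => //.
    rewrite -(fineK (fin_num_measure P _ mB)) lee_fin ler_pdivlMr// mulrC.
    apply: le_trans (AE x); rewrite ler_wpM2r ?fine_ge0//.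
    apply: ge0_ler_powR; rewrite ?nnegrE ?dist_set_ge0 ?(ltW r0) ?(ltW tau0)//.
    exact: ltW.
  move=> y [yM ytau] gy; rewrite /cball/=.
  move: xM yM; rewrite /cball/= !sub0r !(normN hN) => xM yM.
  apply: (@le_trans _ _ (b * tau)); first by apply: gN => //; rewrite gx gy.
  by rewrite ler_pM2l// ltW.
have finT : finite_set [set: T] by exact: finite_finset.
have PW : (P W <= (#|T|%:R * (E / tau `^ r))%:E)%E.
  apply: (@le_trans _ _ (\sum_(t \in [set: T]) P (B t))%E).
    apply: content_sub_fsum => //.
    - by move=> t _; have [] := BP t.
    - by move=> x Wx; exists (g x) => //; have [_ _] := BP (g x); exact.
  rewrite fsbig_finite//=.
  apply: (@le_trans _ _ (\sum_(t <- fset_set [set: T]) (E / tau `^ r)%:E)%E).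
    by apply: lee_sum => t _; have [] := BP t.
  rewrite sumEFin big_const_seq count_predT iter_addr addr0.
  rewrite lee_fin -[leLHS]mulr_natl ler_wpM2r//.
    rewrite divr_ge0 ?powR_ge0//.
    apply: le_trans (AE 0); rewrite mulr_ge0 ?powR_ge0 ?fine_ge0//.
  rewrite ler_nat cardE; apply: uniq_leq_size; first exact: fset_uniq.
  by move=> t _; rewrite mem_enum.
have E0 : 0 <= E.
  by apply: le_trans (AE 0); rewrite mulr_ge0 ?powR_ge0 ?fine_ge0.
move: PW; rewrite -(fineK (fin_num_measure P _ mW)) lee_fin => PW.
apply: (le_trans PW).
rewrite powRD; last by apply/implyP => _; rewrite gt_eqF.
rewrite powR_mulrn ?(ltW tau0)//.
have taud : 0 < tau ^+ d by rewrite exprn_gt0.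
have -> : C / b ^+ d * E / (tau ^+ d * tau `^ r) =
    C / (b * tau) ^+ d * (E / tau `^ r).
  by rewrite exprMn; field; rewrite !gt_eqF.
rewrite ler_wpM2r ?divr_ge0 ?powR_ge0// ler_pdivlMr// exprn_gt0//.
by rewrite mulr_gt0.
Qed.

Lemma dyadic_le (s D0 D : R) n : 0 < s -> 0 < D0 -> 0 <= D <= D0 ->
  D `^ s <= \sum_(0 <= k < n) (D0 * 2^-1 ^+ k) `^ s * (D0 * 2^-1 ^+ k.+1 < D)%R%:R
     + (D0 * 2^-1 ^+ n) `^ s.
Proof.
move=> s0 D00 /andP[D1 D2].
have mono (u v : R) : 0 <= u -> u <= v -> u `^ s <= v `^ s.
  move=> u0 uv; apply: ge0_ler_powR; rewrite ?nnegrE//; first exact: ltW.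
  exact: le_trans uv.
elim: n => [|n ih]; first by rewrite big_geq// add0r expr0 mulr1 mono.
rewrite big_nat_recr//=; have [|nD] := ltP (D0 * 2^-1 ^+ n.+1) D.
  by move=> _; rewrite mulr1 (le_trans ih)// lerDl powR_ge0.
rewrite mulr0 addr0 ler_wpDl ?mono// sumr_ge0// => k _.
by rewrite mulr_ge0 ?powR_ge0.
Qed.

(** For q <= 1 a probability is at most its q-th power, so [weak_type] bounds
the k-th dyadic layer by a multiple of E^q 2^(-k theta). *)
Lemma inner_integral (b r M D0 theta q : R) :
    0 < b -> 0 < r -> 0 <= M -> 0 < D0 -> 0 < theta -> 0 < q <= 1 ->
  exists2 C : R, 0 < C & forall A E, A !=set0 -> 0 < E -> local_bound b r E A ->
    (forall x, N x <= M -> dist_set N x A <= D0) ->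
    (\int[P]_(x in cball N 0 M)
       (dist_set N x A `^ (theta + (d%:R + r) * q))%:E <= (C * E `^ q)%:E)%E.
Proof.
move=> b0 r0 M0 D00 theta0 /andP[q0 q1].
have [C1 C10 weak] := weak_type b0 r0 M0 D00.
set dr := d%:R + r; have dr0 : 0 < dr by rewrite ltr_wpDl.
set s := theta + dr * q; have s0 : 0 < s by rewrite addr_gt0// mulr_gt0.
pose z : R := 2^-1 `^ theta.
have z0 : 0 < z by rewrite powR_gt0// invr_gt0.
have z1 : z < 1.
  rewrite /z -[ltRHS](_ : 1 `^ theta = 1); last by rewrite powR1.
  by apply: gt0_ltr_powR; rewrite ?nnegrE//; lra.
pose K := C1 `^ q / 2^-1 `^ (dr * q) * D0 `^ theta.
have K0 : 0 < K by rewrite mulr_gt0 ?divr_gt0 ?powR_gt0// invr_gt0.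
exists (K / (1 - z) + 1); first by rewrite addr_gt0// divr_gt0// subr_gt0.
move=> A E A0 E0 AE AD.
have Eq : 0 < E `^ q by rewrite powR_gt0.
pose v k : R := D0 * 2^-1 ^+ k.
have v0 k : 0 < v k by rewrite mulr_gt0// exprn_gt0// invr_gt0.
have vD k : v k <= D0.
  by rewrite ler_piMr ?(ltW D00)// exprn_ile1// invf_le1// ler1n.
pose W k := cball N 0 M `&` [set x | v k < dist_set N x A].
have mW k : measurable (W k) := measurable_far M (v k) A0.
(* The layers below v n contribute at most (v n)^s, made negligible here. *)
have [n vn] : exists n, v n `^ s <= E `^ q.
  have : (fun n => v n) @ \oo --> (0 : R).
    rewrite -[X in _ --> X](mulr0 D0); apply: cvgMr.
    by apply: cvg_expr; rewrite ger0_norm ?invr_ge0// invf_lt1// ltr1n.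
  move/cvgrPdist_lt => /(_ (E `^ (q / s))).
  have Es : 0 < E `^ (q / s) by rewrite powR_gt0.
  move=> /(_ Es)[n _ /(_ n (leqnn _))/=]; rewrite sub0r normrN => vE.
  exists n; move: vE; rewrite gtr0_norm// => /ltW vE.
  have -> : E `^ q = (E `^ (q / s)) `^ s by rewrite -powRrM divfK// gt_eqF.
  by apply: ge0_ler_powR; rewrite ?nnegrE ?(ltW s0) ?(ltW (v0 _)) ?(ltW Es).
have mB := measurable_cball hN 0 M.
have PW k : fine (P (W k.+1)) <= (C1 * E / v k.+1 `^ dr) `^ q.
  have := weak A E (v k.+1) A0 AE; rewrite v0 vD -/dr -/(W k.+1) => /(_ isT) h.
  have pW0 : 0 <= fine (P (W k.+1)) by rewrite fine_ge0.
  have pW1 : fine (P (W k.+1)) <= 1.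
    by rewrite -lee_fin fineK ?probability_le1// fin_num_measure.
  apply: (@le_trans _ _ (fine (P (W k.+1)) `^ q)).
    have [->|pW] := eqVneq (fine (P (W k.+1))) 0; first exact: powR_ge0.
    by apply: ger1_powR => //; rewrite lt_neqAle eq_sym pW pW0.
  apply: ge0_ler_powR; rewrite ?nnegrE ?(ltW q0)//.
  exact: le_trans h.
pose f k x := (v k `^ s * \1_(W k.+1) x)%:E.
have f0 k x : (0 <= f k x)%E by rewrite lee_fin mulr_ge0 ?powR_ge0.
have mf k : measurable_fun (cball N 0 M) (f k).
  apply: measurable_funTS; apply/measurable_EFinP.
  by apply: measurable_funM => //; exact: measurable_indic.
apply: (@le_trans _ _ (\int[P]_(x in cball N 0 M)
    (\sum_(0 <= k < n) f k x + (v n `^ s)%:E))%E).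
  apply: le_lower_integral => // x xM.
  - by rewrite lee_fin powR_ge0.
  - by rewrite adde_ge0 ?sume_ge0// lee_fin powR_ge0.
  rewrite /f sumEFin -EFinD lee_fin.
  have xM' : N x <= M by move: xM; rewrite /cball/= sub0r (normN hN).
  have Dx : 0 <= dist_set N x A <= D0 by rewrite dist_set_ge0//= AD.
  apply: (le_trans (dyadic_le n s0 D00 Dx)); rewrite lerD2r.
  apply: ler_sum => k _; rewrite ler_wpM2l ?powR_ge0//.
  rewrite indicE; case: (boolP (D0 * _ < _)) => // vx.
  by rewrite mem_set.
rewrite ge0_integralD//; last 3 first.
- by move=> x _; apply: sume_ge0.
- exact: emeasurable_sum.
- by move=> x _; rewrite lee_fin powR_ge0.
rewrite ge0_integral_sum// integral_cst//.
apply: (@le_trans _ _ (\sum_(0 <= k < n) (K * E `^ q * z ^+ k)%:E + (E `^ q)%:E)%E).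
  apply: leeD; last first.
    apply: (@le_trans _ _ ((v n `^ s)%:E * 1)%E); last by rewrite mule1 lee_fin.
    by apply: lee_wpmul2l; [rewrite lee_fin powR_ge0|exact: probability_le1].
  apply: lee_sum => k _; rewrite /f; under eq_integral do rewrite EFinM.
  rewrite ge0_integralZl_EFin ?powR_ge0//; last first.
  - apply: measurable_funTS; apply/measurable_EFinP; exact: measurable_indic.
  rewrite integral_indic//= (_ : W k.+1 `&` _ = W k.+1); last first.
    by rewrite /W setIAC setIid.
  rewrite -(fineK (fin_num_measure P _ (mW k.+1))) -EFinM lee_fin.
  apply: (le_trans (ler_wpM2l (powR_ge0 _ _) (PW k))).
  rewrite le_eqVlt; apply/orP; left; apply/eqP.
  have vS : v k.+1 = v k * 2^-1 by rewrite /v exprSr mulrA.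
  have vz : v k `^ theta = D0 `^ theta * z ^+ k.
    rewrite /v powRM ?(ltW D00) ?exprn_ge0 ?invr_ge0//.
    by rewrite -!powR_mulrn ?powR_ge0 ?invr_ge0// powRAC.
  have vs : v k `^ s = v k `^ theta * v k `^ (dr * q).
    by rewrite powRD//; apply/implyP => _; rewrite gt_eqF.
  have vV : ((v k.+1 `^ dr)^-1) `^ q = (v k `^ (dr * q) * 2^-1 `^ (dr * q))^-1.
    rewrite -powRN -powRrM mulNr powRN vS powRM ?(ltW (v0 _)) ?invr_ge0//.
  rewrite vs vz powRM ?vV; last 2 first.
  - by rewrite mulr_ge0 ?ltW//.
  - by rewrite invr_ge0 powR_ge0.
  rewrite powRM ?(ltW C10) ?(ltW E0)// /K; field.
  by rewrite !gt_eqF ?powR_gt0 ?invr_gt0.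
rewrite sumEFin -EFinD lee_fin mulrDl mul1r lerD2r -mulr_sumr.
rewrite [leRHS]mulrAC (ler_pM2l (mulr_gt0 K0 Eq)).
have z1' : 0 < 1 - z by rewrite subr_gt0.
have -> : \sum_(0 <= k < n) z ^+ k = (1 - z ^+ n) / (1 - z).
  elim: (n) => [|m ih]; first by rewrite big_geq// expr0 subrr mul0r.
  by rewrite big_nat_recr//= ih exprS; field; rewrite gt_eqF.
rewrite -[leRHS]mul1r ler_wpM2r ?invr_ge0 ?(ltW z1')// lerBlDl lerDr.
by rewrite exprn_ge0// ltW.
Qed.

End inner_outer.

(** * The mismatched error far from the origin, and its rate *)

Section outer.
Context {R : realType} {d : nat} {N : 'rV[R]_d -> R}.
Hypothesis hN : is_norm N.
Hypothesis d_gt0 : (0 < d)%N.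
Variable P : probability 'rV[R]_d R.
Implicit Types (x y a : 'rV[R]_d) (A : set 'rV[R]_d).
Local Notation mesh := (@mesh R d).

(** The radius t = b D(x) is admissible in the supremum, and for it the numerator
is at least of order D(x)^d and the denominator at most E / D(x)^r. A null ball
makes the ratio infinite. *)
Lemma le_sup_ball_ratio (c b r E : R) A x :
    0 < c -> 0 < b -> 0 < r -> 0 < E ->
    (forall x t, 0 <= t -> ((c * t ^+ d)%:E <= lebesgue_rV d (cball N x t))%E) ->
    local_bound (N := N) P b r E A ->
    0 < dist_set N x A <= 2 * N x ->
  ((c * b ^+ d / E * dist_set N x A `^ (d%:R + r))%:E <=
    sup_ball_ratio N P x (2 * b * N x))%E.
Proof.
move=> c0 b0 r0 E0 leb AE; set D := dist_set N x A => /andP[D0 DN].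
have bD0 : 0 < b * D by rewrite mulr_gt0.
have bD : 0 <= b * D <= 2 * b * N x.
  by rewrite (ltW bD0)/= (mulrC 2) -mulrA ler_pM2l.
apply: le_trans (ereal_sup_ubound _); last by exists (b * D).
set B := cball N x (b * D).
have mB : measurable B := measurable_cball hN _ _.
have lB : ((c * (b * D) ^+ d)%:E <= lebesgue_rV d B)%E := leb x _ (ltW bD0).
have cB : 0 < c * (b * D) ^+ d by rewrite mulr_gt0// exprn_gt0.
have lB0 : (0 < lebesgue_rV d B)%E by apply: lt_le_trans lB; rewrite lte_fin.
have PB0 : (0 <= P B)%E by exact: measure_ge0.
have [PB|PB] := eqVneq (P B) 0%E.
  by rewrite PB inve0 gt0_muley ?leey.
have PBfin : P B \is a fin_num := fin_num_measure P _ mB.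
have p0 : 0 < fine (P B) by rewrite fine_gt0// lt0e PB PB0 -ge0_fin_numE.
rewrite -(fineK PBfin) inver (gt_eqF p0).
apply: (@le_trans _ _ ((c * (b * D) ^+ d)%:E * (fine (P B))^-1%:E)%E); last first.
  by apply: lee_wpmul2r => //; rewrite lee_fin invr_ge0 ltW.
rewrite -EFinM lee_fin ler_pdivlMr//.
rewrite powRD ?powR_mulrn ?(ltW D0)//; last by apply/implyP => _; rewrite gt_eqF.
have := AE x; rewrite /= -/D -/B => h.
have -> : c * b ^+ d / E * (D ^+ d * D `^ r) * fine (P B) =
    c * (b * D) ^+ d * (D `^ r * fine (P B) / E).
  by rewrite exprMn; field; rewrite gt_eqF.
by rewrite ler_piMr ?(ltW cB)// ler_pdivrMr// mul1r.
Qed.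

Lemma outer_integral (b r M M' theta q : R) :
    0 < b -> 0 < r -> 0 < theta -> 0 < q -> M <= M' ->
    (ball_ratio_integral N P M b q theta < +oo)%E ->
  exists2 C : R, 0 < C & forall A E, A !=set0 -> 0 < E ->
    local_bound (N := N) P b r E A ->
    (forall x, M' < N x -> dist_set N x A <= 2 * N x) ->
    (\int[P]_(x in ~` cball N 0 M')
       (dist_set N x A `^ (theta + (d%:R + r) * q))%:E <= (C * E `^ q)%:E)%E.
Proof.
move=> b0 r0 theta0 q0 MM' Ifin.
have [c c0 leb] := lebesgue_cball_ge hN.
set dr := d%:R + r; have dr0 : 0 < dr by rewrite ltr_wpDl.
set s := theta + dr * q; have s0 : 0 < s by rewrite addr_gt0// mulr_gt0.
have I0 : (0 <= ball_ratio_integral N P M b q theta)%E.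
  by apply: integral_ge0 => x _; rewrite mule_ge0 ?poweR_ge0// lee_fin powR_ge0.
pose I := fine (ball_ratio_integral N P M b q theta).
have IE : ball_ratio_integral N P M b q theta = I%:E.
  by rewrite fineK// ge0_fin_numE.
have I0' : 0 <= I by rewrite -lee_fin -IE.
pose kap := (c * b ^+ d) `^ q * 2^-1 `^ theta.
have kap0 : 0 < kap.
  by rewrite mulr_gt0// powR_gt0 ?invr_gt0// mulr_gt0// exprn_gt0.
exists (kap^-1 * (I + 1)); first by rewrite mulr_gt0 ?invr_gt0// ltr_wpDl.
move=> A E A0 E0 AE AD.
have Eq : 0 < E `^ q by rewrite powR_gt0.
have kE : 0 < kap / E `^ q by rewrite divr_gt0.
have mBC : measurable (~` cball N 0 M').
  by apply: measurableC; exact: measurable_cball.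
suff : ((kap / E `^ q)%:E *
    \int[P]_(x in ~` cball N 0 M') (dist_set N x A `^ s)%:E <= I%:E)%E.
  rewrite muleC -lee_pdivlMr// => h; apply: (le_trans h).
  rewrite -EFinM lee_fin invf_div.
  have -> : kap^-1 * (I + 1) * E `^ q = (I + 1) * (E `^ q / kap) by ring.
  by rewrite ler_wpM2r ?lerDl// divr_ge0 ?ltW//.
rewrite -IE -ge0_integralZl_EFin//; last 3 first.
- by move=> x _; rewrite lee_fin powR_ge0.
- by apply: measurable_funTS; exact: measurable_dist_set.
- exact: ltW.
apply: le_lower_integral => x /=.
- rewrite /cball/= sub0r (normN hN) => /negP; rewrite -ltNge => xM xM'.
  by move: xM; rewrite ltNge (le_trans xM').
- by move=> _; rewrite -EFinM lee_fin mulr_ge0 ?powR_ge0// ltW.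
- by move=> _; rewrite mule_ge0 ?poweR_ge0// lee_fin powR_ge0.
rewrite /cball/= sub0r (normN hN) => /negP; rewrite -ltNge => xM.
set D := dist_set N x A.
have [D0|D0] := eqVneq D 0.
  rewrite D0 powR0 ?gt_eqF// mule0.
  by rewrite mule_ge0 ?poweR_ge0// lee_fin powR_ge0.
have Dgt0 : 0 < D by rewrite lt_neqAle eq_sym D0; exact: dist_set_ge0.
have DN : D <= 2 * N x := AD x xM.
have D2 : 0 < D <= 2 * N x by rewrite Dgt0.
have ratio := le_sup_ball_ratio c0 b0 r0 E0 leb AE D2.
rewrite -/D -/dr in ratio.
have L0 : 0 <= c * b ^+ d / E * D `^ dr.
  by rewrite mulr_ge0 ?powR_ge0// divr_ge0 ?(ltW E0)// mulr_ge0 ?(ltW c0)// exprn_ge0// ltW.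
have ratioq : (((c * b ^+ d / E * D `^ dr) `^ q)%:E <=
    sup_ball_ratio N P x (2 * b * N x) `^ q)%E.
  rewrite -poweR_EFin; apply: gt0_ler_poweR => //; first exact: ltW.
    by rewrite in_itv/= lee_fin L0 leey.
  rewrite in_itv/= leey andbT; apply: le_trans ratio; by rewrite lee_fin.
apply: (@le_trans _ _ (((c * b ^+ d / E * D `^ dr) `^ q)%:E * ((2^-1 * D) `^ theta)%:E)%E).
  rewrite -!EFinM lee_fin le_eqVlt; apply/orP; left; apply/eqP.
  have -> : D `^ s = D `^ theta * D `^ (dr * q).
    by rewrite powRD//; apply/implyP.
  have EV : E^-1 `^ q = (E `^ q)^-1.
    by rewrite -[E^-1](powR_inv1 (ltW E0)) -powRrM mulN1r powRN.
  have cb0 : 0 <= c * b ^+ d by rewrite mulr_ge0 ?(ltW c0)// exprn_ge0// ltW.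
  rewrite (@powRM _ _ (D `^ dr)) ?powR_ge0 ?divr_ge0 ?(ltW E0)//.
  rewrite (@powRM _ _ E^-1) ?invr_ge0 ?(ltW E0)// EV -powRrM.
  rewrite (@powRM _ 2^-1) ?invr_ge0 ?(ltW Dgt0)// /kap.
  by rewrite mulrAC; ring.
apply: lee_pmul => //; rewrite ?lee_fin ?powR_ge0//.
apply: ge0_ler_powR; rewrite ?nnegrE ?(ltW theta0) ?mulr_ge0 ?invr_ge0 ?(ltW Dgt0) ?(norm_ge0 hN)//.
by rewrite ler_pdivrMl.
Qed.

(** The two regions are separated at a radius M' above M, where the hypothesis
starts, and above the bound M0' on D(0), so that D(x) <= ||x|| + M0' is at most
2 ||x|| beyond M'. *)
Lemma mismatch_rate (r delta s theta q M b : R)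
    (Pa : {measure set 'rV[R]_d -> \bar R}) (alpha : nat -> set 'rV[R]_d) :
    0 < r -> 0 < delta -> 0 < theta -> 0 < q <= 1 -> 0 <= M -> 0 < b < 1 / 2 ->
    s = theta + (d%:R + r) * q ->
    is_ac_part (lebesgue_rV d) P Pa ->
    (exists2 A, measurable A & Pa A != 0%E) ->
    (\int[P]_x (N x `^ (r + delta))%:E < +oo)%E ->
    (forall n, (1 <= n)%N -> is_optimal_quantizer N P r n (alpha n)) ->
    (ball_ratio_integral N P M b q theta < +oo)%E ->
  exists2 C : R, 0 < C & forall n, (0 < n)%N ->
    (quantization_error N P s (alpha n) <=
      (C * n%:R `^ (- ((s - theta) / d%:R)))%:E)%E.
Proof.
move=> r0 delta0 theta0 q01 M0 b01 sE Pac Pa0 mom opt Ifin.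
have /andP[b0 _] := b01; have /andP[q0 _] := q01.
have [C1 C10 rate] := optimal_error_rate hN d_gt0 r0 delta0 mom opt.
have [C2 C20 mm] := micro_macro hN d_gt0 r0 delta0 b01 Pac Pa0 mom opt.
have al0 n : (0 < n)%N -> alpha n !=set0 by move=> /opt[].
have mr : (\int[P]_x (N x `^ r)%:E < +oo)%E.
  by apply: moment_le mom => //; rewrite (ltW r0) lerDl ltW.
have [M0' M0'0 alM] := dist0_bounded hN r0 C10 mr al0 rate.
pose M' := Num.max M M0'.
have M'0 : 0 <= M' by rewrite le_max M0.
have MM' : M <= M' by rewrite le_max lexx.
have MM0 : M0' <= M' by rewrite le_max lexx orbT.
have D0 : 0 < M' + M0' + 1 by rewrite ltr_wpDl// addr_ge0.
have [Ci Ci0 inner] := inner_integral hN P b0 r0 M'0 D0 theta0 q01.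
have [Co Co0 outer] := outer_integral b0 r0 theta0 q0 MM' Ifin.
exists ((Ci + Co) * C2 `^ q); first by rewrite mulr_gt0 ?powR_gt0 ?addr_gt0.
move=> n n0; have u0 : 0 < mesh n := mesh_gt0 n0.
set E := C2 * mesh n `^ (d%:R + r).
have E0 : 0 < E by rewrite mulr_gt0// powR_gt0.
have AE : local_bound (N := N) P b r E (alpha n) by move=> x; exact: mm.
have Dx x : dist_set N x (alpha n) <= N x + M0'.
  apply: (le_trans (dist_set_tri hN x 0 (al0 n n0))).
  by rewrite subr0 lerD2l alM.
have mB := measurable_cball hN 0 M'.
have EqE : (Ci + Co) * C2 `^ q * n%:R `^ (- ((s - theta) / d%:R)) =
    (Ci + Co) * E `^ q.
  rewrite -mulrA; congr (_ * _); rewrite /E powRM ?(ltW C20) ?powR_ge0//.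
  congr (_ * _); rewrite /mesh -!powRrM; congr (_ `^ _).
  by rewrite sE; field; rewrite pnatr_eq0 -lt0n.
rewrite EqE mulrDl EFinD /quantization_error -(setUv (cball N 0 M')).
rewrite ge0_integral_setU//; last 4 first.
- exact: measurableC.
- by rewrite setUv; exact: measurable_dist_set (al0 n n0).
- by move=> x _; rewrite lee_fin powR_ge0.
- by apply/disj_setPCl.
apply: leeD; rewrite sE.
  apply: inner => //; first exact: al0.
  by move=> x xM; rewrite (le_trans (Dx x))// -addrA lerD// lerDl.
apply: outer => //; first exact: al0.
move=> x xM; rewrite (le_trans (Dx x))// mulr2n mulrDl mul1r lerD2l.
exact: le_trans MM0 (ltW xM).
Qed.

End outer.

Theorem proposition1 (R : realType) (d : nat) (d_gt0 : (0 < d)%N)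
    (N : 'rV[R]_d -> R) (N_norm : is_norm N)
    (r : R) (r_gt0 : 0 < r)
    (P : probability 'rV[R]_d R)
    (Pa : {measure set 'rV[R]_d -> \bar R})
    (Pa_ac : is_ac_part (lebesgue_rV d) P Pa)
    (Pa_neq0 : exists2 A, measurable A & Pa A != 0%E)
    (P_moment : exists2 delta : R, 0 < delta &
      (\int[P]_x (N x `^ (r + delta))%:E < +oo)%E)
    (alpha : nat -> set 'rV[R]_d)
    (alpha_opt : forall n, (1 <= n)%N -> is_optimal_quantizer N P r n (alpha n)) :
  ((exists2 theta0 : R, 0 < theta0 &
      forall theta : R, 0 < theta < Num.min theta0 (d%:R + r) ->
      exists M b : R, [/\ 0 <= M, 0 < b < 1 / 2 &
        (ball_ratio_integral N P M b (1 - theta / (d%:R + r)) theta < +oo)%E]) ->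
   forall eps : R, 0 < eps < 1 + r / d%:R ->
     (limn_esup (fun n => (n%:R `^ (1 + r / d%:R - eps))%:E *
                          quantization_error N P (d%:R + r)%R (alpha n)) < +oo)%E)
  /\
  (forall s : R, d%:R + r < s ->
   forall theta M b : R, s - (d%:R + r) < theta < s -> 0 <= M -> 0 < b < 1 / 2 ->
     (ball_ratio_integral N P M b ((s - theta) / (d%:R + r)) theta < +oo)%E ->
     (ereal_sup [set (n%:R `^ ((s - theta) / d%:R))%:E *
                     quantization_error N P s (alpha n)
                | n in [set n | (1 <= n)%N]] < +oo)%E).
Proof.
have [delta delta0 mom] := P_moment.
have dR : 0 < d%:R :> R by rewrite ltr0n.
have dr0 : 0 < d%:R + r by rewrite addr_gt0.
(* Multiplying an error of order n^-t by n^p with p <= t leaves it bounded. *)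
have scale (s C p t : R) n : (0 < n)%N -> 0 < C -> p <= t ->
    (quantization_error N P s (alpha n) <= (C * n%:R `^ (- t))%:E)%E ->
    ((n%:R `^ p)%:E * quantization_error N P s (alpha n) <= C%:E)%E.
  move=> n0 C0 pt err.
  apply: (@le_trans _ _ ((n%:R `^ p)%:E * (C * n%:R `^ (- t))%:E)%E).
    by apply: lee_wpmul2l => //; rewrite lee_fin powR_ge0.
  rewrite -EFinM lee_fin mulrCA ler_piMr ?(ltW C0)// powRN.
  rewrite ler_pdivrMr ?powR_gt0 ?ltr0n// mul1r.
  by apply: ler_powR => //; rewrite ler1n.
split; last first.
  move=> s s_gt theta M b /andP[theta1 theta2] M0 b01 Ifin.
  have theta0 : 0 < theta by apply: le_lt_trans theta1; rewrite subr_ge0 ltW.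
  have q01 : 0 < (s - theta) / (d%:R + r) <= 1.
    rewrite divr_gt0 ?subr_gt0//= ler_pdivrMr// mul1r lerBlDr -lerBlDl.
    exact: ltW.
  have sE : s = theta + (d%:R + r) * ((s - theta) / (d%:R + r)).
    by field; rewrite gt_eqF.
  have [C C0 err] := mismatch_rate N_norm d_gt0 r_gt0 delta0 theta0 q01 M0 b01 sE
    Pa_ac Pa_neq0 mom alpha_opt Ifin.
  apply: (@le_lt_trans _ _ C%:E); last exact: ltry.
  apply: ge_ereal_sup => _ [n /= n0 <-].
  exact: scale n0 C0 (lexx _) (err n n0).
move=> [theta0 theta0_gt0 H] eps /andP[eps0 eps1].
(* The loss theta / d in the exponent has to stay below eps. *)
pose theta := Num.min (Num.min (theta0 / 2) ((d%:R + r) / 2)) (eps * d%:R).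
have theta_gt0 : 0 < theta by rewrite !lt_min !divr_gt0//= mulr_gt0.
have theta_dr : theta < d%:R + r.
  by rewrite !gt_min; apply/orP; left; apply/orP; right; lra.
have theta_lt : 0 < theta < Num.min theta0 (d%:R + r).
  rewrite theta_gt0/= lt_min theta_dr andbT.
  by rewrite !gt_min; apply/orP; left; apply/orP; left; lra.
have [M [b [M0 b01 Ifin]]] := H theta theta_lt.
have q01 : 0 < 1 - theta / (d%:R + r) <= 1.
  rewrite subr_gt0 ltr_pdivrMr// mul1r theta_dr/= gerBl.
  by rewrite divr_ge0// ltW.
have sE : d%:R + r = theta + (d%:R + r) * (1 - theta / (d%:R + r)).
  by field; rewrite gt_eqF.
have [C C0 err] := mismatch_rate N_norm d_gt0 r_gt0 delta0 theta_gt0 q01 M0 b01 sE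
  Pa_ac Pa_neq0 mom alpha_opt Ifin.
have pt : 1 + r / d%:R - eps <= (d%:R + r - theta) / d%:R.
  have -> : (d%:R + r - theta) / d%:R = 1 + r / d%:R - theta / d%:R.
    by field; rewrite gt_eqF.
  by rewrite lerD2l lerN2 ler_pdivrMr// !ge_min lexx orbT.
apply: (@le_lt_trans _ _ C%:E); last exact: ltry.
rewrite /limn_esup limf_esupE; apply: ge_ereal_inf; eexists.
  by exists [set n | (0 < n)%N] => //; exists 1%N.
apply: ge_ereal_sup => _ [n /= n0 <-].
exact: scale n0 C0 pt (err n n0).
Qed.
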